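(* Let $H$ be a coquasi-Hopf algebra and $(R,\cdot,\sigma)$ an $H$-crossed system with convolution invertible cocycle $\sigma$. Then the functors $-\otimes H:\mathcal{M}_R\to(\mathcal{M}_R^H)_H$ and $(-)^{coH}:(\mathcal{M}_R^H)_H\to\mathcal{M}_R$ define a pair of inverse equivalences between the category $\mathcal{M}_R$ of right $R$-modules and the category $(\mathcal{M}_R^H)_H$ of right coquasi-Hopf modules.
   Context: All vector spaces, algebras and tensor products are over a fixed field $\Bbbk$; Sweedler notation is used: $\Delta(h)=h_1\otimes h_2$, $\rho(m)=m_0\otimes m_1$. Coquasi-bialgebra: a coassociative counital coalgebra $(H,\Delta,\varepsilon)$ with coalgebra morphisms $m:H\otimes H\to H$ (written $h\otimes g\mapsto hg$) and $u:\Bbbk\to H$ (with $u(1)=1_H$), and a convolution invertible $\omega\in(H\otimes H\otimes H)^*$ such that for all $h,g,k,l\in H$: $h_1(g_1k_1)\omega(h_2,g_2,k_2)=\omega(h_1,g_1,k_1)(h_2g_2)k_2$; $1_Hh=h1_H=h$; $\omega(h_1,g_1,k_1l_1)\omega(h_2g_2,k_2,l_2)=\omega(g_1,k_1,l_1)\omega(h_1,g_2k_2,l_2)\omega(h_2,g_3,k_3)$; $\omega(h,1_H,g)=\varepsilon(h)\varepsilon(g)$. Coquasi-Hopf algebra: a coquasi-bialgebra $H$ with a coalgebra antihomomorphism $S:H\to H$ and $\alpha,\beta\in H^*$ such that $S(h_1)\alpha(h_2)h_3=\alpha(h)1_H$, $h_1\beta(h_2)S(h_3)=\beta(h)1_H$,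 and $\omega(h_1,S(h_3),h_5)\beta(h_2)\alpha(h_4)=\omega^{-1}(S(h_1),h_3,S(h_5))\alpha(h_2)\beta(h_4)=\varepsilon(h)$ for all $h\in H$. One assumes, after rescaling, $\alpha(1_H)=\beta(1_H)=1$. $H$-crossed system $(R,\cdot,\sigma)$: an associative unital algebra $R$, a bilinear map $\cdot:H\otimes R\to R$ and a linear map $\sigma:H\otimes H\to R$ such that for all $h,g,l\in H$, $r,s\in R$: $h\cdot(rs)=(h_1\cdot r)(h_2\cdot s)$, $h\cdot 1_R=\varepsilon(h)1_R$, $1_H\cdot r=r$, $[h_1\cdot(g_1\cdot r)]\sigma(h_2,g_2)=\sigma(h_1,g_1)[(h_2g_2)\cdot r]$, $\sigma(h,1_H)=\sigma(1_H,h)=\varepsilon(h)1_R$, $[h_1\cdot\sigma(g_1,l_1)]\sigma(h_2,g_2l_2)=\sigma(h_1,g_1)\sigma(h_2g_2,l_1)\omega^{-1}(h_3,g_3,l_2)$. Convolution invertibility of $\sigma$ is in $Hom(H\otimes H,R)$. Category $\mathcal{M}_R^H$: right $R$-modules that are right $H$-comodules with $\rho_M(mr)=m_0r\otimes m_1$. Right $(R,H)$-coquasi-Hopf module: an object $M$ of $\mathcal{M}_R^H$ with a linear map $\circ:M\otimes H\to M$ such that $\rho_M(m\circ h)=m_0\circ h_1\otimes m_1h_2$; $(m\circ h)r=[m(h_1\cdot r)]\circ h_2$; $(m\circ h)\circ g=[m_0\sigma(h_1,g_1)]\circ(h_2g_2)\,\omega(m_1,h_3,g_3)$; $m\circ 1_H=m$.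 $(\mathcal{M}_R^H)_H$ is the category of these; morphisms are the right $R$-linear, right $H$-colinear maps commuting with $\circ$. Functors: for $N\in\mathcal{M}_R$, $N\otimes H$ is a coquasi-Hopf module via $(n\otimes h)r=n(h_1\cdot r)\otimes h_2$, $\rho(n\otimes h)=n\otimes h_1\otimes h_2$, $(n\otimes h)\circ g=n\sigma(h_1,g_1)\otimes h_2g_2$. For $M\in(\mathcal{M}_R^H)_H$, $M^{coH}=\{m\in M:\rho_M(m)=m\otimes 1_H\}$, a right $R$-module by restriction of the $R$-action of $M$. *)

(* Defs.v *)
From HB Require Import structures.
From mathcomp Require Import all_boot all_order all_algebra.
From mathcomp Require Import boolp.

Set Implicit Arguments.
Unset Strict Implicit.
Unset Printing Implicit Defensive.

Import GRing.Theory.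
Local Open Scope ring_scope.
Local Open Scope quotient_scope.

Section Tensor.
Variables (k : fieldType) (U V : lmodType k).

(* The tensor product U (x) V over k: a sequence of pairs stands for the formal
   sum of the corresponding pure tensors (scalars are absorbed in the left
   factor), and [teq] is the congruence generated by bilinearity. *)
Inductive teq : seq (U * V) -> seq (U * V) -> Prop :=
| teq_refl s : teq s s
| teq_sym s t : teq s t -> teq t s
| teq_trans t s r : teq s t -> teq t r -> teq s r
| teq_cat s s' t t' : teq s s' -> teq t t' -> teq (s ++ t) (s' ++ t')
| teq_catC s t : teq (s ++ t) (t ++ s)
| teq0 v : teq [:: (0, v)] [::]
| teqDl u u' v : teq [:: (u + u', v)] [:: (u, v); (u', v)]
| teqDr u v v' : teq [:: (u, v + v')] [:: (u, v); (u, v')]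
| teqZ a u v : teq [:: (a *: u, v)] [:: (u, a *: v)].

Definition teqb : rel (seq (U * V)) := fun s t => `[< teq s t >].

Lemma teqb_refl : reflexive teqb.
Proof. by move=> s; apply/asboolP; apply: teq_refl. Qed.
Lemma teqb_sym : symmetric teqb.
Proof. by move=> s t; apply/asboolP/asboolP; apply: teq_sym. Qed.
Lemma teqb_trans : transitive teqb.
Proof.
by move=> t s r /asboolP st /asboolP tr; apply/asboolP; apply: teq_trans tr.
Qed.
Canonical teqb_equiv := EquivRel teqb teqb_refl teqb_sym teqb_trans.

Definition tens := {eq_quot teqb}.
HB.instance Definition _ := Choice.on tens.

Definition tens_of (s : seq (U * V)) : tens := \pi_{eq_quot teqb} s.
Definition terms (t : tens) : seq (U * V) := repr (t : {eq_quot teqb}).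

Lemma termsK t : tens_of (terms t) = t.
Proof. exact: reprK. Qed.
Lemma tens_ofP s t : tens_of s = tens_of t <-> teq s t.
Proof.
split; first by move/(@eqmodP _ _ s t)/asboolP.
by move=> st; apply/(@eqmodP _ _ s t)/asboolP.
Qed.
Lemma teq_terms s : teq (terms (tens_of s)) s.
Proof. by apply/tens_ofP; rewrite termsK. Qed.

Definition tens_map (f : U -> U) (s : seq (U * V)) := [seq (f p.1, p.2) | p <- s].

Lemma teq_map (a : k) s t : teq s t -> teq (tens_map ( *:%R a) s) (tens_map ( *:%R a) t).
Proof.
elim=> {s t} /=.
- by move=> s; apply: teq_refl.
- by move=> s t _; apply: teq_sym.
- by move=> t s r _ st _; apply: teq_trans.
- by move=> s s' t t' _ ss' _ tt'; rewrite /tens_map !map_cat; apply: teq_cat.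
- by move=> s t; rewrite /tens_map !map_cat; apply: teq_catC.
- by move=> v; rewrite scaler0; apply: teq0.
- by move=> u u' v; rewrite scalerDr; apply: teqDl.
- by move=> u v v'; apply: teqDr.
- by move=> b u v; rewrite scalerA mulrC -scalerA; apply: teqZ.
Qed.

Definition tens_add (s t : tens) := tens_of (terms s ++ terms t).
Definition tens_scale a (s : tens) := tens_of (tens_map ( *:%R a) (terms s)).

Lemma tens_of_cat s t : tens_of (s ++ t) = tens_add (tens_of s) (tens_of t).
Proof.
by apply/tens_ofP/teq_sym/teq_cat; apply: teq_terms.
Qed.
Lemma tens_of_scale a s :
  tens_scale a (tens_of s) = tens_of (tens_map ( *:%R a) s).
Proof. by apply/tens_ofP/teq_map/teq_terms. Qed.

Lemma tens_addA : associative tens_add.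
Proof.
move=> s t r; rewrite -(termsK s) -(termsK t) -(termsK r).
by rewrite -!tens_of_cat catA.
Qed.
Lemma tens_addC : commutative tens_add.
Proof. by move=> s t; apply/tens_ofP/teq_catC. Qed.
Lemma tens_add0 : left_id (tens_of [::]) tens_add.
Proof. by move=> s; rewrite -{1}(termsK s) -tens_of_cat termsK. Qed.
Lemma tens_addN : left_inverse (tens_of [::]) (tens_scale (-1)) tens_add.
Proof.
move=> s; rewrite -(termsK s) tens_of_scale.
elim: (terms s) => [|[u v] s' IHs] /=; first by rewrite -tens_of_cat.
rewrite -[_ :: tens_map _ _]cat1s -[_ :: s']cat1s !tens_of_cat.
rewrite tens_addA (tens_addC (tens_of [:: _])) -(tens_addA (tens_of (tens_map _ _))).
suff -> : tens_add (tens_of [:: (-1 *: u, v)]) (tens_of [:: (u, v)]) = tens_of [::].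
  by rewrite (tens_addC _ (tens_of [::])) tens_add0 IHs.
rewrite -tens_of_cat; apply/tens_ofP; apply: teq_trans (teq0 v).
by rewrite -(addNr u) scaleN1r; apply/teq_sym/teqDl.
Qed.

HB.instance Definition _ :=
  GRing.isZmodule.Build tens tens_addA tens_addC tens_add0 tens_addN.

Lemma tens_scaleA a b s :
  tens_scale a (tens_scale b s) = tens_scale (a * b) s.
Proof.
rewrite -(termsK s) !tens_of_scale /tens_map -map_comp; congr tens_of.
by apply: eq_map => p /=; rewrite scalerA.
Qed.
Lemma tens_scale1 : left_id 1 tens_scale.
Proof.
move=> s; rewrite -(termsK s) tens_of_scale /tens_map; congr tens_of.
by rewrite -[RHS]map_id; apply: eq_map => -[u v] /=; rewrite scale1r.
Qed.
Lemma tens_scaleDr : right_distributive tens_scale +%R.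
Proof.
move=> a s t; rewrite -(termsK s) -(termsK t) /GRing.add /= -tens_of_cat.
by rewrite !tens_of_scale /tens_map map_cat tens_of_cat.
Qed.
Lemma tens_ofD s t : tens_of (s ++ t) = tens_of s + tens_of t.
Proof. exact: tens_of_cat. Qed.
Lemma tens_scaleDl s : {morph tens_scale^~ s : a b / a + b}.
Proof.
move=> a b; rewrite -(termsK s) !tens_of_scale.
elim: (terms s) => [|[u v] s' IHs] /=; first by rewrite addr0.
rewrite -[_ :: tens_map (_ (a + b)) _]cat1s -[_ :: tens_map (_ a) _]cat1s.
rewrite -[_ :: tens_map (_ b) _]cat1s !tens_ofD IHs addrACA; congr (_ + _).
by rewrite -tens_ofD scalerDl; apply/tens_ofP/teqDl.
Qed.
HB.instance Definition _ := GRing.Zmodule_isLmodule.Build k tens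
  tens_scaleA tens_scale1 tens_scaleDr tens_scaleDl.

Definition pure (u : U) (v : V) : tens := tens_of [:: (u, v)].
End Tensor.

Notation "U ⊗ V" := (tens U%type V%type) (at level 40, left associativity) : type_scope.
Notation "u ⊗ v" := (pure u v) (at level 40, left associativity) : ring_scope.

Section Multilinear.
Variables (k : fieldType).
Implicit Types U V W X : lmodType k.

Definition is_lin U V (f : U -> V) : Prop := linear f.

Definition bilin U V X (f : U -> V -> X) : Prop :=
  (forall v, is_lin (fun u => f u v)) /\ (forall u, is_lin (fun v => f u v)).

Definition trilin U V W X (f : U -> V -> W -> X) : Prop :=
  [/\ forall v w, is_lin (fun u => f u v w),
      forall u w, is_lin (fun v => f u v w) &
      forall u v, is_lin (fun w => f u v w)].

(* Value at t = \sum_i u_i (x) v_i of the map induced on the tensor product by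
   a bilinear f.  It is computed on a chosen representative; by [tsum_pure] and
   [tsum_lin] the choice does not matter when f is bilinear. *)
Definition tsum U V (W : zmodType) (t : U ⊗ V) (f : U -> V -> W) : W :=
  \sum_(p <- terms t) f p.1 p.2.
End Multilinear.

Notation "'\tsum_' ( a , b <- t ) e" := (tsum t (fun a b => e))
  (at level 41, a name, b name, t at level 35, e at level 41,
   format "\tsum_ ( a ,  b  <-  t )  e") : ring_scope.

Section TensorTheory.
Variables (k : fieldType).
Implicit Types U V W X : lmodType k.

Lemma is_lin_additive U X (f : U -> X) : is_lin f ->
  [/\ f 0 = 0, forall x y, f (x + y) = f x + f y & forall a x, f (a *: x) = a *: f x].
Proof.
move=> fL.
have fD x y : f (x + y) = f x + f y by rewrite -[x]scale1r fL !scale1r.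
have f0 : f 0 = 0 by apply: (addrI (f 0)); rewrite -fD !addr0.
by split=> // a x; rewrite -[a *: x]addr0 fL f0 addr0.
Qed.

Lemma bilin_teq U V X (f : U -> V -> X) (s t : seq (U * V)) : bilin f ->
  teq s t -> \sum_(p <- s) f p.1 p.2 = \sum_(p <- t) f p.1 p.2.
Proof.
move=> [fl fr]; elim=> {s t} //=.
- by move=> t s r _ -> _.
- by move=> s s' t t' _ e1 _ e2; rewrite !big_cat /= e1 e2.
- by move=> s t; rewrite !big_cat /= addrC.
- by move=> v; rewrite big_seq1 big_nil /=; case: (is_lin_additive (fl v)).
- move=> u u' v; rewrite !big_cons !big_nil /= !addr0.
  by case: (is_lin_additive (fl v)).
- move=> u v v'; rewrite !big_cons !big_nil /= !addr0.
  by case: (is_lin_additive (fr u)).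
- move=> a u v; rewrite !big_seq1 /=.
  case: (is_lin_additive (fr u)) => _ _ ->.
  by case: (is_lin_additive (fl v)) => _ _ ->.
Qed.

Lemma tsum_of U V X (f : U -> V -> X) s : bilin f ->
  tsum (tens_of s) f = \sum_(p <- s) f p.1 p.2.
Proof. by move=> fB; apply/bilin_teq/teq_terms. Qed.

Lemma tsum_pure U V X (f : U -> V -> X) u v : bilin f -> tsum (u ⊗ v) f = f u v.
Proof. by move=> fB; rewrite tsum_of // big_seq1. Qed.

Lemma pureD U V (u u' : U) (v : V) : (u + u') ⊗ v = u ⊗ v + u' ⊗ v.
Proof. by rewrite -tens_ofD; apply/tens_ofP/teqDl. Qed.

Lemma pure_bilin U V : bilin (@pure k U V).
Proof.
have zE a (u : U) (v : V) : (a *: u) ⊗ v = a *: (u ⊗ v).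
  by rewrite /GRing.scale /= tens_of_scale.
split=> [v a u u'|u a v v']; first by rewrite pureD zE.
rewrite -zE; have -> : (a *: u) ⊗ v = u ⊗ (a *: v) by apply/tens_ofP/teqZ.
by rewrite -tens_ofD; apply/tens_ofP/teqDr.
Qed.

Lemma tsum_lin U V X (f : U -> V -> X) : bilin f -> is_lin (fun t => tsum t f).
Proof.
move=> fB a s t; rewrite -(termsK s) -(termsK t).
have -> : a *: tens_of (terms s) = tens_of (tens_map ( *:%R a) (terms s)).
  by rewrite /GRing.scale /= tens_of_scale.
rewrite -tens_ofD !tsum_of // big_cat scaler_sumr /tens_map big_map /=.
congr (_ + _); apply: eq_bigr => p _.
by case: fB => fl _; case: (is_lin_additive (fl p.2)) => _ _ ->.
Qed.

Lemma tsum_id U V (t : U ⊗ V) : \tsum_(a, b <- t) a ⊗ b = t.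
Proof.
rewrite -[RHS]termsK /tsum; elim: (terms t) => [|p s IHs]; first by rewrite big_nil.
by rewrite big_cons IHs -tens_ofD; case: p.
Qed.

Lemma eq_tsum U V (X : zmodType) (t : U ⊗ V) (f g : U -> V -> X) :
  (forall a b, f a b = g a b) -> tsum t f = tsum t g.
Proof. by move=> fg; apply: eq_bigr. Qed.

Lemma lin_sum U X (g : U -> X) I (s : seq I) (F : I -> U) :
  is_lin g -> g (\sum_(i <- s) F i) = \sum_(i <- s) g (F i).
Proof.
by case/is_lin_additive=> g0 gD _; apply: (big_morph g gD g0).
Qed.

Lemma lin_tsumE U V W X (g : W -> X) (t : U ⊗ V) f :
  is_lin g -> g (tsum t f) = \tsum_(a, b <- t) g (f a b).
Proof. exact: lin_sum. Qed.

Lemma tsum_tsum U V U' V' X (t : U ⊗ V) (f : U -> V -> U' ⊗ V') (g : U' -> V' -> X) :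
  bilin g -> tsum (tsum t f) g = \tsum_(a, b <- t) tsum (f a b) g.
Proof. by move=> /tsum_lin gL; rewrite (lin_tsumE _ _ gL). Qed.

Lemma exchange_tsum U V U' V' (X : zmodType) (t : U ⊗ V) (t' : U' ⊗ V')
    (f : U -> V -> U' -> V' -> X) :
  \tsum_(a, b <- t) \tsum_(c, d <- t') f a b c d =
  \tsum_(c, d <- t') \tsum_(a, b <- t) f a b c d.
Proof. exact: exchange_big. Qed.

Lemma lin_id U : is_lin (fun x : U => x). Proof. by []. Qed.
Lemma lin_comp U V W (g : V -> W) (f : U -> V) :
  is_lin g -> is_lin f -> is_lin (fun x => g (f x)).
Proof. by move=> gL fL a x y; rewrite fL gL. Qed.
Lemma lin_bl U V W X (g : V -> W -> X) (f : U -> V) w :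
  bilin g -> is_lin f -> is_lin (fun x => g (f x) w).
Proof. by move=> [gL _] fL; apply: (lin_comp (gL w) fL). Qed.
Lemma lin_br U V W X (g : W -> V -> X) (f : U -> V) w :
  bilin g -> is_lin f -> is_lin (fun x => g w (f x)).
Proof. by move=> [_ gL] fL; apply: (lin_comp (gL w) fL). Qed.
Lemma lin_t1 U V W W' X (g : V -> W -> W' -> X) (f : U -> V) w w' :
  trilin g -> is_lin f -> is_lin (fun x => g (f x) w w').
Proof. by move=> [gL _ _] fL; apply: (lin_comp (gL w w') fL). Qed.
Lemma lin_t2 U V W W' X (g : W -> V -> W' -> X) (f : U -> V) w w' :
  trilin g -> is_lin f -> is_lin (fun x => g w (f x) w').
Proof. by move=> [_ gL _] fL; apply: (lin_comp (gL w w') fL). Qed.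
Lemma lin_t3 U V W W' X (g : W -> W' -> V -> X) (f : U -> V) w w' :
  trilin g -> is_lin f -> is_lin (fun x => g w w' (f x)).
Proof. by move=> [_ _ gL] fL; apply: (lin_comp (gL w w') fL). Qed.
Lemma lin_scale U V (a : k) (f : U -> V) :
  is_lin f -> is_lin (fun x => a *: f x).
Proof. by move=> fL b x y; rewrite fL scalerDr !scalerA mulrC. Qed.
Lemma lin_scalel U V (s : U -> k^o) (v : V) :
  is_lin s -> is_lin (fun x => (s x : k) *: v).
Proof. by move=> sL b x y; rewrite sL scalerDl scalerA. Qed.
Lemma lin_tsumr U V W X (t : U ⊗ V) (f : X -> U -> V -> W) :
  (forall a b, is_lin (fun x => f x a b)) -> is_lin (fun x => tsum t (f x)).
Proof.
move=> fL b x y; rewrite /tsum scaler_sumr -big_split /=.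
by apply: eq_bigr => p _; rewrite fL.
Qed.
Lemma lin_tsuml U V W X (t : X -> U ⊗ V) (f : U -> V -> W) :
  bilin f -> is_lin t -> is_lin (fun x => tsum (t x) f).
Proof. by move=> /tsum_lin fL tL; apply: (lin_comp fL tL). Qed.
Lemma linear_is_lin U V (f : {linear U -> V}) : is_lin f.
Proof. exact: linearP. Qed.
Lemma scalar_is_lin U (f : {scalar U}) : is_lin (f : U -> k^o).
Proof. exact: linearP. Qed.
End TensorTheory.

Create HintDb multilinear.
#[global] Hint Resolve pure_bilin linear_is_lin scalar_is_lin : multilinear.

(* The library's [algType] requires 1 != 0; here an associative unital algebra
   may be zero. *)
Record algebra (k : fieldType) := Algebra {
  alg_sort :> lmodType k;
  amul : alg_sort -> alg_sort -> alg_sort;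
  aone : alg_sort;
  amul_bilin : bilin amul;
  amulA : associative amul;
  amul1l : left_id aone amul;
  amul1r : right_id aone amul }.

Arguments aone {k a}.
Notation "r ∙ s" := (amul r s) (at level 40, left associativity) : ring_scope.

Record coalgebra (k : fieldType) := Coalgebra {
  coalg_sort :> lmodType k;
  comul : {linear coalg_sort -> (coalg_sort ⊗ coalg_sort)%type};
  counit : {scalar coalg_sort};
  comulA : forall h,
    \tsum_(h1, h2 <- comul h) comul h1 ⊗ h2 =
    \tsum_(h1, h' <- comul h) \tsum_(h2, h3 <- comul h') (h1 ⊗ h2) ⊗ h3;
  counitl : forall h, \tsum_(h1, h2 <- comul h) counit h1 *: h2 = h;
  counitr : forall h, \tsum_(h1, h2 <- comul h) counit h2 *: h1 = h }.

Arguments comul {k c}.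
Arguments counit {k c}.

(* Sweedler sums h_1 (x) h_2, h_1 (x) h_2 (x) h_3, and so on; as for [tsum],
   they are meaningful when the summand is multilinear. *)
Section Sweedler.
Variables (k : fieldType) (H : coalgebra k) (W : zmodType).

Definition sw2 (h : H) (f : H -> H -> W) : W := tsum (comul h) f.
Definition sw3 (h : H) (f : H -> H -> H -> W) : W :=
  sw2 h (fun h1 h' => sw2 h' (fun h2 h3 => f h1 h2 h3)).
Definition sw5 (h : H) (f : H -> H -> H -> H -> H -> W) : W :=
  sw3 h (fun h1 h2 h' => sw3 h' (fun h3 h4 h5 => f h1 h2 h3 h4 h5)).
End Sweedler.

Notation "'\sw_' ( a , b <- h ) e" := (sw2 h (fun a b => e))
  (at level 41, a name, b name, h at level 35, e at level 41,
   format "\sw_ ( a ,  b  <-  h )  e") : ring_scope.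
Notation "'\sw_' ( a , b , c <- h ) e" := (sw3 h (fun a b c => e))
  (at level 41, a name, b name, c name, h at level 35, e at level 41,
   format "\sw_ ( a ,  b ,  c  <-  h )  e") : ring_scope.
Notation "'\sw_' ( a , b , c , d , x <- h ) e" := (sw5 h (fun a b c d x => e))
  (at level 41, a name, b name, c name, d name, x name, h at level 35,
   e at level 41,
   format "\sw_ ( a ,  b ,  c ,  d ,  x  <-  h )  e") : ring_scope.

Reserved Notation "x ∗ y" (at level 40, left associativity).

(* Linear maps out of tensor products are curried into multilinear ones: the
   product is bilinear, and [omega] and its (unique) convolution inverse
   [omegaV] are trilinear forms.  That the product and the unit are coalgebra
   morphisms is expressed by [comulM], [counitM], [comul1] and [counit1]. *)
Record coquasiBialgebra (k : fieldType) := CoquasiBialgebra {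
  cqb_coalg :> coalgebra k;
  bmul : cqb_coalg -> cqb_coalg -> cqb_coalg
    where "x ∗ y" := (bmul x y);
  bone : cqb_coalg;
  omega : cqb_coalg -> cqb_coalg -> cqb_coalg -> k;
  omegaV : cqb_coalg -> cqb_coalg -> cqb_coalg -> k;
  bmul_bilin : bilin bmul;
  omega_trilin : trilin (omega : _ -> _ -> _ -> k^o);
  omegaV_trilin : trilin (omegaV : _ -> _ -> _ -> k^o);
  comulM : forall h g, comul (h ∗ g) =
    \sw_(h1, h2 <- h) \sw_(g1, g2 <- g) (h1 ∗ g1) ⊗ (h2 ∗ g2);
  counitM : forall h g : cqb_coalg, counit (h ∗ g) = counit h * counit g;
  comul1 : comul bone = bone ⊗ bone;
  counit1 : counit bone = 1;
  omegaVr : forall h g l,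
    \sw_(h1, h2 <- h) \sw_(g1, g2 <- g) \sw_(l1, l2 <- l)
      (omega h1 g1 l1 * omegaV h2 g2 l2) = counit h * counit g * counit l;
  omegaVl : forall h g l,
    \sw_(h1, h2 <- h) \sw_(g1, g2 <- g) \sw_(l1, l2 <- l)
      (omegaV h1 g1 l1 * omega h2 g2 l2) = counit h * counit g * counit l;
  bmulA : forall h g l,
    \sw_(h1, h2 <- h) \sw_(g1, g2 <- g) \sw_(l1, l2 <- l)
      omega h2 g2 l2 *: (h1 ∗ (g1 ∗ l1)) =
    \sw_(h1, h2 <- h) \sw_(g1, g2 <- g) \sw_(l1, l2 <- l)
      omega h1 g1 l1 *: ((h2 ∗ g2) ∗ l2);
  bmul1l : forall h, bone ∗ h = h;
  bmul1r : forall h, h ∗ bone = h;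
  omega_cocycle : forall h g l m,
    \sw_(h1, h2 <- h) \sw_(g1, g2 <- g) \sw_(l1, l2 <- l) \sw_(m1, m2 <- m)
      (omega h1 g1 (l1 ∗ m1) * omega (h2 ∗ g2) l2 m2) =
    \sw_(h1, h2 <- h) \sw_(g1, g2, g3 <- g) \sw_(l1, l2, l3 <- l)
    \sw_(m1, m2 <- m)
      (omega g1 l1 m1 * omega h1 (g2 ∗ l2) m2 * omega h2 g3 l3);
  omega_unit : forall h g, omega h bone g = counit h * counit g }.

Notation "x ∗ y" := (bmul x y) : ring_scope.
Arguments bone {k c}.

Record coquasiHopf (k : fieldType) := CoquasiHopf {
  cqh_cqb :> coquasiBialgebra k;
  antipode : {linear cqh_cqb -> cqh_cqb};
  alpha : {scalar cqh_cqb};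
  beta : {scalar cqh_cqb};
  (* the antipode is an antihomomorphism of coalgebras *)
  comul_antipode : forall h : cqh_cqb,
    comul (antipode h) = \sw_(h1, h2 <- h) antipode h2 ⊗ antipode h1;
  counit_antipode : forall h, counit (antipode h) = counit h;
  antipode_alpha : forall h : cqh_cqb,
    \sw_(h1, h2, h3 <- h) alpha h2 *: (antipode h1 ∗ h3) = alpha h *: bone;
  antipode_beta : forall h : cqh_cqb,
    \sw_(h1, h2, h3 <- h) beta h2 *: (h1 ∗ antipode h3) = beta h *: bone;
  omega_antipode : forall h : cqh_cqb,
    \sw_(h1, h2, h3, h4, h5 <- h)
      (omega h1 (antipode h3) h5 * beta h2 * alpha h4) = counit h;
  omegaV_antipode : forall h : cqh_cqb,
    \sw_(h1, h2, h3, h4, h5 <- h)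
      (omegaV (antipode h1) h3 (antipode h5) * alpha h2 * beta h4) = counit h;
  (* normalization, achieved by rescaling alpha and beta *)
  alpha1 : alpha bone = 1;
  beta1 : beta bone = 1 }.

Arguments antipode {k c}.
Arguments alpha {k c}.
Arguments beta {k c}.

(* [cact h r] is h . r; [sigma] is a linear map on H (x) H, curried. *)
Record crossedSystem (k : fieldType) (H : coquasiBialgebra k)
    (R : algebra k) := CrossedSystem {
  cact : H -> R -> R;
  sigma : H -> H -> R;
  cact_bilin : bilin cact;
  sigma_bilin : bilin sigma;
  cactM : forall h r s,
    cact h (r ∙ s) = \sw_(h1, h2 <- h) (cact h1 r ∙ cact h2 s);
  cact1 : forall h, cact h aone = counit h *: aone;
  cact_bone : forall r, cact bone r = r;
  sigma_cact : forall h g r,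
    \sw_(h1, h2 <- h) \sw_(g1, g2 <- g) (cact h1 (cact g1 r) ∙ sigma h2 g2) =
    \sw_(h1, h2 <- h) \sw_(g1, g2 <- g) (sigma h1 g1 ∙ cact (h2 ∗ g2) r);
  sigma1r : forall h, sigma h bone = counit h *: aone;
  sigma1l : forall h, sigma bone h = counit h *: aone;
  sigma_cocycle : forall h g l,
    \sw_(h1, h2 <- h) \sw_(g1, g2 <- g) \sw_(l1, l2 <- l)
      (cact h1 (sigma g1 l1) ∙ sigma h2 (g2 ∗ l2)) =
    \sw_(h1, h2, h3 <- h) \sw_(g1, g2, g3 <- g) \sw_(l1, l2 <- l)
      omegaV h3 g3 l2 *: (sigma h1 g1 ∙ sigma (h2 ∗ g2) l1) }.

(* invertibility in the convolution algebra Hom(H (x) H, R), with unit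
   h (x) g |-> epsilon(h) epsilon(g) 1_R *)
Definition conv_invertible (k : fieldType) (H : coalgebra k) (R : algebra k)
    (s : H -> H -> R) : Prop :=
  exists t : H -> H -> R, bilin t /\ forall h g,
    \sw_(h1, h2 <- h) \sw_(g1, g2 <- g) (s h1 g1 ∙ t h2 g2)
      = (counit h * counit g) *: aone /\
    \sw_(h1, h2 <- h) \sw_(g1, g2 <- g) (t h1 g1 ∙ s h2 g2)
      = (counit h * counit g) *: aone.

(* Bilinearity of [ract] over k makes the k-structure of the module the one
   induced by its R-structure. *)
Record rightModule (k : fieldType) (R : algebra k) := RightModule {
  rmod_sort :> lmodType k;
  ract : rmod_sort -> R -> rmod_sort;
  ract_bilin : bilin ract;
  ractA : forall m r s, ract (ract m r) s = ract m (r ∙ s);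
  ract1 : forall m, ract m aone = m }.

Notation "m ◃ r" := (ract m r) (at level 40, left associativity) : ring_scope.

(* objects of the category M_R^H *)
Record modComodule (k : fieldType) (H : coalgebra k) (R : algebra k) :=
  ModComodule {
  mc_rmod :> rightModule R;
  coact : {linear mc_rmod -> (mc_rmod ⊗ H)%type};
  coactA : forall m,
    \tsum_(m0, m1 <- coact m) coact m0 ⊗ m1 =
    \tsum_(m0, m' <- coact m) \sw_(m1, m2 <- m') (m0 ⊗ m1) ⊗ m2;
  coact_counit : forall m, \tsum_(m0, m1 <- coact m) counit m1 *: m0 = m;
  coact_ract : forall m r,
    coact (m ◃ r) = \tsum_(m0, m1 <- coact m) (m0 ◃ r) ⊗ m1 }.

Arguments coact {k H R m0}.

Reserved Notation "m ∘ h" (at level 40, left associativity).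

Record coquasiHopfModule (k : fieldType) (H : coquasiBialgebra k)
    (R : algebra k) (C : crossedSystem H R) := CoquasiHopfModule {
  chm_mc :> modComodule H R;
  hact : chm_mc -> H -> chm_mc where "m ∘ h" := (hact m h);
  hact_bilin : bilin hact;
  coact_hact : forall m h, coact (m ∘ h) =
    \tsum_(m0, m1 <- coact m) \sw_(h1, h2 <- h) (m0 ∘ h1) ⊗ (m1 ∗ h2);
  hact_ract : forall m h r,
    (m ∘ h) ◃ r = \sw_(h1, h2 <- h) (m ◃ cact C h1 r) ∘ h2;
  hactA : forall m h g, (m ∘ h) ∘ g =
    \tsum_(m0, m1 <- coact m) \sw_(h1, h2, h3 <- h) \sw_(g1, g2, g3 <- g)
      omega m1 h3 g3 *: ((m0 ◃ sigma C h1 g1) ∘ (h2 ∗ g2));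
  hact1 : forall m, m ∘ bone = m }.

Notation "m ∘ h" := (hact m h) : ring_scope.

Record category := Category {
  ob :> Type;
  hom : ob -> ob -> Type;
  idm : forall A, hom A A;
  cmp : forall A B D, hom B D -> hom A B -> hom A D;
  cmp1m : forall A B (f : hom A B), cmp (idm B) f = f;
  cmpm1 : forall A B (f : hom A B), cmp f (idm A) = f;
  cmpA : forall A B D E (f : hom D E) (g : hom B D) (h : hom A B),
    cmp f (cmp g h) = cmp (cmp f g) h }.

Record functor (A B : category) := Functor {
  fob :> A -> B;
  fmap : forall X Y, hom X Y -> hom (fob X) (fob Y);
  fmap1 : forall X, fmap (idm X) = idm (fob X);
  fmapM : forall X Y Z (f : hom Y Z) (g : hom X Y),
    fmap (cmp f g) = cmp (fmap f) (fmap g) }.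

Section CategoryTheory.
Variables A B D : category.

Definition id_functor : functor A A.
Proof. by exists (fun X => X) (fun X Y f => f). Defined.

Definition comp_functor (G : functor B D) (F : functor A B) : functor A D.
Proof.
exists (fun X => G (F X)) (fun X Y f => fmap G (fmap F f)).
- by move=> X; rewrite !fmap1.
- by move=> X Y Z f g; rewrite !fmapM.
Defined.

Record natIso (F G : functor A B) := NatIso {
  niso : forall X, hom (F X) (G X);
  nisoV : forall X, hom (G X) (F X);
  nisoK : forall X, cmp (nisoV X) (niso X) = idm (F X);
  nisoVK : forall X, cmp (niso X) (nisoV X) = idm (G X);
  niso_nat : forall X Y (f : hom X Y),
    cmp (niso Y) (fmap F f) = cmp (fmap G f) (niso X) }.
End CategoryTheory.

Definition inverse_equivalences (A B : category)
    (F : functor A B) (G : functor B A) : Prop :=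
  inhabited (natIso (comp_functor G F) (id_functor A)) /\
  inhabited (natIso (comp_functor F G) (id_functor B)).

#[global] Hint Resolve amul_bilin bmul_bilin omega_trilin omegaV_trilin
  cact_bilin sigma_bilin ract_bilin hact_bilin : multilinear.

(* discharges goals [is_lin _], [bilin _] and [trilin _] by closure properties *)
Ltac mlin :=
  rewrite /sw3 /sw2; cbv beta;
  lazymatch goal with
  | |- forall _, _ => intro; mlin
  | |- bilin _ => first [solve [auto with multilinear] | split; mlin]
  | |- trilin _ => first [solve [auto with multilinear] | split; mlin]
  | |- is_lin (fun x => x) => exact: lin_id
  | |- is_lin (fun x => tsum _ _) =>
    match goal with
    | |- is_lin (fun x => tsum ?t (@?f x)) => apply: (@lin_tsumr _ _ _ _ _ t f)
    | |- is_lin (fun x => tsum (@?t x) ?f) => apply: (@lin_tsuml _ _ _ _ _ t f)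
    end; mlin
  | |- is_lin (fun x => _ *: _) =>
    match goal with
    | |- is_lin (fun x => ?a *: (@?f x)) => apply: (@lin_scale _ _ _ a f)
    | |- is_lin (fun x => (@?s x) *: ?v) => apply: (@lin_scalel _ _ _ s v)
    end; mlin
  | |- is_lin _ =>
    match goal with
    | |- is_lin ?f => solve [auto with multilinear]
    | |- @is_lin _ _ ?X (fun x => ?g (@?f x)) =>
        apply: (@lin_comp _ _ _ X g f); [solve [auto with multilinear] | mlin]
    | |- @is_lin _ _ ?X (fun x => ?g (@?f x) ?w) =>
        apply: (@lin_bl _ _ _ _ X g f w); [solve [auto with multilinear] | mlin]
    | |- @is_lin _ _ ?X (fun x => ?g ?w (@?f x)) =>
        apply: (@lin_br _ _ _ _ X g f w); [solve [auto with multilinear] | mlin]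
    | |- @is_lin _ _ ?X (fun x => ?g (@?f x) ?w ?w') =>
        apply: (@lin_t1 _ _ _ _ _ X g f w w'); [solve [auto with multilinear] | mlin]
    | |- @is_lin _ _ ?X (fun x => ?g ?w (@?f x) ?w') =>
        apply: (@lin_t2 _ _ _ _ _ X g f w w'); [solve [auto with multilinear] | mlin]
    | |- @is_lin _ _ ?X (fun x => ?g ?w ?w' (@?f x)) =>
        apply: (@lin_t3 _ _ _ _ _ X g f w w'); [solve [auto with multilinear] | mlin]
    end
  end.

Section SweedlerTheory.
Variables (k : fieldType) (H : coalgebra k) (W : lmodType k).

Lemma sw_coassoc (F : H -> H -> H -> W) h : trilin F ->
  \sw_(a, b <- h) \sw_(c, d <- a) F c d b =
  \sw_(a, b <- h) \sw_(c, d <- b) F a c d.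
Proof.
move=> FT; rewrite /sw2.
pose G (t : (H ⊗ H) ⊗ H) := \tsum_(x, b <- t) \tsum_(c, d <- x) F c d b.
have GL : is_lin G by rewrite /G; mlin.
transitivity (G (\tsum_(a, b <- comul h) comul a ⊗ b)).
  rewrite (lin_tsumE _ _ GL); apply: eq_tsum => a b.
  by rewrite /G tsum_pure //; mlin.
rewrite comulA (lin_tsumE _ _ GL); apply: eq_tsum => a x.
rewrite (lin_tsumE _ _ GL); apply: eq_tsum => b c.
by rewrite /G tsum_pure; [rewrite tsum_pure //; mlin | mlin].
Qed.

Lemma sw_counitl (F : H -> W) h : is_lin F ->
  \sw_(a, b <- h) counit a *: F b = F h.
Proof.
move=> FL; rewrite -[in RHS](counitl h) (lin_tsumE _ _ FL).
by apply: eq_tsum => a b; case: (is_lin_additive FL) => _ _ ->.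
Qed.

Lemma sw_counitr (F : H -> W) h : is_lin F ->
  \sw_(a, b <- h) counit b *: F a = F h.
Proof.
move=> FL; rewrite -[in RHS](counitr h) (lin_tsumE _ _ FL).
by apply: eq_tsum => a b; case: (is_lin_additive FL) => _ _ ->.
Qed.

Lemma eq_sw (X : zmodType) (h : H) (F G : H -> H -> X) :
  (forall a b, F a b = G a b) -> sw2 h F = sw2 h G.
Proof. exact: eq_tsum. Qed.

Lemma exchange_sw (X : zmodType) (h g : H) (F : H -> H -> H -> H -> X) :
  \sw_(a, b <- h) \sw_(c, d <- g) F a b c d =
  \sw_(c, d <- g) \sw_(a, b <- h) F a b c d.
Proof. exact: exchange_tsum. Qed.

Lemma sw_coassoc2 (F : H -> H -> H -> H -> H -> H -> W) h g :
  (forall a b c, trilin (fun x y z => F x a y b z c)) ->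
  (forall a b c, trilin (fun x y z => F a x b y c z)) ->
  \sw_(a, b <- h) \sw_(c, d <- g) \sw_(a1, a2 <- a) \sw_(c1, c2 <- c)
    F a1 c1 a2 c2 b d =
  \sw_(a, b <- h) \sw_(c, d <- g) \sw_(b1, b2 <- b) \sw_(d1, d2 <- d)
    F a c b1 d1 b2 d2.
Proof.
move=> F1 F2.
transitivity (\sw_(a, b <- h) \sw_(a1, a2 <- a) \sw_(c, d <- g)
   \sw_(c1, c2 <- c) F a1 c1 a2 c2 b d).
  by apply: eq_sw => a b; rewrite exchange_sw.
rewrite (sw_coassoc (F := fun a1 a2 b => \sw_(c, d <- g)
   \sw_(c1, c2 <- c) F a1 c1 a2 c2 b d)); last first.
  by split=> u v; apply: lin_tsumr => c d; apply: lin_tsumr => c1 c2;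
     case: (F1 c1 c2 d).
apply: eq_sw => a b; rewrite [RHS]exchange_sw; apply: eq_sw => b1 b2.
exact: (sw_coassoc (F := fun c1 c2 d => F a c1 b1 c2 b2 d) _ (F2 _ _ _)).
Qed.

Lemma sw_coassoc3 (F : H -> H -> H -> H -> H -> H -> H -> H -> H -> W) h g l :
  (forall a b c a' b' c', trilin (fun x y z => F x a a' y b b' z c c')) ->
  (forall a b c a' b' c', trilin (fun x y z => F a x a' b y b' c z c')) ->
  (forall a b c a' b' c', trilin (fun x y z => F a a' x b b' y c c' z)) ->
  \sw_(a, b <- h) \sw_(c, d <- g) \sw_(e, f <- l)
  \sw_(a1, a2 <- a) \sw_(c1, c2 <- c) \sw_(e1, e2 <- e)
    F a1 c1 e1 a2 c2 e2 b d f =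
  \sw_(a, b <- h) \sw_(c, d <- g) \sw_(e, f <- l)
  \sw_(b1, b2 <- b) \sw_(d1, d2 <- d) \sw_(f1, f2 <- f)
    F a c e b1 d1 f1 b2 d2 f2.
Proof.
move=> F1 F2 F3.
transitivity (\sw_(a, b <- h) \sw_(c, d <- g) \sw_(a1, a2 <- a)
  \sw_(c1, c2 <- c) \sw_(e, f <- l) \sw_(e1, e2 <- e)
    F a1 c1 e1 a2 c2 e2 b d f).
  apply: eq_sw => a b; apply: eq_sw => c d.
  by rewrite exchange_sw; apply: eq_sw => a1 a2; rewrite exchange_sw.
rewrite (sw_coassoc2 (F := fun a1 c1 a2 c2 b d => \sw_(e, f <- l)
   \sw_(e1, e2 <- e) F a1 c1 e1 a2 c2 e2 b d f)).
- apply: eq_sw => a b; apply: eq_sw => c d; rewrite [RHS]exchange_sw.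
  apply: eq_sw => b1 b2; rewrite [RHS]exchange_sw; apply: eq_sw => d1 d2.
  exact: (sw_coassoc (F := fun e1 e2 f => F a c e1 b1 d1 e2 b2 d2 f) _ (F3 _ _ _ _ _ _)).
- by move=> a b c; split=> u v; apply: lin_tsumr => e f;
     apply: lin_tsumr => e1 e2; case: (F1 a b c e1 e2 f).
- by move=> a b c; split=> u v; apply: lin_tsumr => e f;
     apply: lin_tsumr => e1 e2; case: (F2 a b c e1 e2 f).
Qed.

Definition sw22 (X : zmodType) (h : H) (F : H -> H -> H -> H -> X) : X :=
  \sw_(a, b <- h) \sw_(a1, a2 <- a) \sw_(b1, b2 <- b) F a1 a2 b1 b2.

Lemma eq_sw3 (X : zmodType) (h : H) (F G : H -> H -> H -> X) :
  (forall a b c, F a b c = G a b c) -> sw3 h F = sw3 h G.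
Proof. by move=> FG; apply: eq_sw => a x; apply: eq_sw => b c. Qed.

Lemma eq_sw22 (X : zmodType) (h : H) (F G : H -> H -> H -> H -> X) :
  (forall a b c d, F a b c d = G a b c d) -> sw22 h F = sw22 h G.
Proof. by move=> FG; do 3!apply: eq_sw => ? ?. Qed.

Lemma exchange_sw3 (X : zmodType) (h g : H) (F : H -> H -> H -> H -> H -> X) :
  \sw_(a, b <- h) \sw_(c, d, e <- g) F a b c d e =
  \sw_(c, d, e <- g) \sw_(a, b <- h) F a b c d e.
Proof.
by rewrite /sw3 exchange_sw; apply: eq_sw => c x; rewrite exchange_sw.
Qed.

Lemma exchange_sw_sw (X : zmodType) (h g l : H)
    (F : H -> H -> H -> H -> H -> H -> X) :
  \sw_(a, b <- h) \sw_(c, d <- g) \sw_(e, f <- l) F a b c d e f =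
  \sw_(c, d <- g) \sw_(e, f <- l) \sw_(a, b <- h) F a b c d e f.
Proof. by rewrite exchange_sw; apply: eq_sw => c d; rewrite exchange_sw. Qed.

Lemma exchange_sw22 (X : zmodType) (h g : H)
    (F : H -> H -> H -> H -> H -> H -> X) :
  sw22 h (fun a b c d => \sw_(x, y <- g) F a b c d x y) =
  \sw_(x, y <- g) sw22 h (fun a b c d => F a b c d x y).
Proof.
rewrite /sw22 [RHS]exchange_sw; apply: eq_sw => a b.
rewrite [RHS]exchange_sw; apply: eq_sw => a1 a2.
by rewrite [RHS]exchange_sw.
Qed.

Lemma sw22_mid (F : H -> H -> H -> H -> W) h :
  (forall d, trilin (fun a b c => F a b c d)) ->
  (forall a b c, is_lin (fun d => F a b c d)) ->
  \sw_(x, d <- h) \sw_(a, b, c <- x) F a b c d = sw22 h F.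
Proof.
move=> F1 F2; rewrite /sw22.
transitivity (\sw_(x, d <- h) \sw_(y, c <- x) \sw_(a, b <- y) F a b c d).
  by apply: eq_sw => x d; rewrite /sw3 -(sw_coassoc (F := fun a b c => F a b c d)).
rewrite (sw_coassoc (F := fun y c d => \sw_(a, b <- y) F a b c d)).
  by apply: eq_sw => x y; rewrite exchange_sw.
split=> [u v|u v|u v].
- apply: (@lin_tsuml _ _ _ _ _ comul); last by mlin.
  by split=> w; case: (F1 v).
- by apply: lin_tsumr => a b; case: (F1 v).
- by apply: lin_tsumr => a b.
Qed.

Lemma sw22_midr (F : H -> H -> H -> H -> W) h :
  (forall a, trilin (fun b c d => F a b c d)) ->
  (forall b c d, is_lin (fun a => F a b c d)) ->
  \sw_(a, x, d <- h) \sw_(b, c <- x) F a b c d = sw22 h F.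
Proof.
move=> F1 F2; rewrite /sw22 /sw3.
transitivity (\sw_(a, x <- h) \sw_(b, y <- x) \sw_(c, d <- y) F a b c d).
  by apply: eq_sw => a x; rewrite (sw_coassoc (F := fun b c d => F a b c d)).
rewrite -(sw_coassoc (F := fun a b y => \sw_(c, d <- y) F a b c d)) //.
split=> [u v|u v|u v].
- by apply: lin_tsumr => c d.
- by apply: lin_tsumr => c d; case: (F1 u).
- apply: (@lin_tsuml _ _ _ _ _ comul); last by mlin.
  by split=> w; case: (F1 u).
Qed.
End SweedlerTheory.

Lemma tens_ext (k : fieldType) (U V X : lmodType k) (f g : U ⊗ V -> X) t :
  is_lin f -> is_lin g -> (forall u v, f (u ⊗ v) = g (u ⊗ v)) -> f t = g t.
Proof.
move=> fL gL fg; rewrite -(tsum_id t) (lin_tsumE _ _ fL) (lin_tsumE _ _ gL).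
exact: eq_tsum.
Qed.

Lemma sw_mul (k : fieldType) (H : coquasiBialgebra k) (W : lmodType k)
    (F : H -> H -> W) h g : bilin F ->
  \sw_(a, b <- h ∗ g) F a b =
  \sw_(h1, h2 <- h) \sw_(g1, g2 <- g) F (h1 ∗ g1) (h2 ∗ g2).
Proof.
move=> FB; rewrite /sw2 comulM (tsum_tsum _ _ FB); apply: eq_tsum => h1 h2.
by rewrite (tsum_tsum _ _ FB); apply: eq_tsum => g1 g2; rewrite tsum_pure.
Qed.

Definition mk_linear (k : fieldType) (U V : lmodType k) (f : U -> V)
  (fL : is_lin f) : {linear U -> V} :=
  HB.pack f (GRing.isLinear.Build k U V *:%R f fL).

(* the coquasi-Hopf module N (x) H *)
Section InducedModule.
Variables (k : fieldType) (H : coquasiBialgebra k) (R : algebra k).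
Variables (C : crossedSystem H R) (N : rightModule R).

Definition ind_ract (x : N ⊗ H) (r : R) : N ⊗ H :=
  \tsum_(n, h <- x) \sw_(h1, h2 <- h) (n ◃ cact C h1 r) ⊗ h2.
Definition ind_coact (x : N ⊗ H) : (N ⊗ H) ⊗ H :=
  \tsum_(n, h <- x) \sw_(h1, h2 <- h) (n ⊗ h1) ⊗ h2.
Definition ind_hact (x : N ⊗ H) (g : H) : N ⊗ H :=
  \tsum_(n, h <- x) \sw_(h1, h2 <- h) \sw_(g1, g2 <- g)
    (n ◃ sigma C h1 g1) ⊗ (h2 ∗ g2).

Lemma ind_ract_bilin : bilin ind_ract.
Proof. by rewrite /ind_ract; mlin. Qed.
Lemma ind_coact_lin : is_lin ind_coact.
Proof. by rewrite /ind_coact; mlin. Qed.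
Lemma ind_hact_bilin : bilin ind_hact.
Proof. by rewrite /ind_hact; mlin. Qed.
Hint Resolve ind_ract_bilin ind_coact_lin ind_hact_bilin : multilinear.

Lemma ind_ractE n h r :
  ind_ract (n ⊗ h) r = \sw_(h1, h2 <- h) (n ◃ cact C h1 r) ⊗ h2.
Proof. by rewrite /ind_ract tsum_pure //; mlin. Qed.
Lemma ind_coactE n h :
  ind_coact (n ⊗ h) = \sw_(h1, h2 <- h) (n ⊗ h1) ⊗ h2.
Proof. by rewrite /ind_coact tsum_pure //; mlin. Qed.
Lemma ind_hactE n h g :
  ind_hact (n ⊗ h) g =
  \sw_(h1, h2 <- h) \sw_(g1, g2 <- g) (n ◃ sigma C h1 g1) ⊗ (h2 ∗ g2).
Proof. by rewrite /ind_hact tsum_pure //; mlin. Qed.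

Lemma lin_swE (X Y : lmodType k) (f : X -> Y) (h : H) F :
  is_lin f -> f (sw2 h F) = \sw_(h1, h2 <- h) f (F h1 h2).
Proof. exact: lin_tsumE. Qed.

Lemma ind_ractA x r s : ind_ract (ind_ract x r) s = ind_ract x (r ∙ s).
Proof.
apply: (@tens_ext _ _ _ _ (fun x => ind_ract (ind_ract x r) s)
  (fun x => ind_ract x (r ∙ s))); [mlin | mlin | move=> n h].
rewrite !ind_ractE (lin_swE (f := fun y => ind_ract y s)); last by mlin.
under eq_sw => a b do rewrite ind_ractE.
rewrite -(sw_coassoc (F := fun a c d => (n ◃ cact C a r ◃ cact C c s) ⊗ d));
  last by mlin.
apply: eq_sw => a b.
rewrite cactM (lin_swE (f := fun y => (n ◃ y) ⊗ b)); last by mlin.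
by apply: eq_sw => a1 a2; rewrite ractA.
Qed.

Lemma ind_ract1 x : ind_ract x aone = x.
Proof.
apply: (@tens_ext _ _ _ _ (fun x => ind_ract x aone) (fun x => x));
  [mlin | mlin | move=> n h].
rewrite ind_ractE -(sw_counitl (F := fun h => n ⊗ h)); last by mlin.
apply: eq_sw => a b; rewrite cact1.
case: (is_lin_additive (f := fun y => (n ◃ y) ⊗ b)) => [|_ _ ->]; first by mlin.
by rewrite ract1.
Qed.

Definition ind_rmodule : rightModule R :=
  RightModule ind_ract_bilin ind_ractA ind_ract1.

Lemma ind_coactA x :
  \tsum_(m0, m1 <- ind_coact x) ind_coact m0 ⊗ m1 =
  \tsum_(m0, m' <- ind_coact x) \sw_(m1, m2 <- m') (m0 ⊗ m1) ⊗ m2.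
Proof.
apply: (@tens_ext _ _ _ _
  (fun x => \tsum_(m0, m1 <- ind_coact x) ind_coact m0 ⊗ m1)
  (fun x => \tsum_(m0, m' <- ind_coact x) \sw_(m1, m2 <- m') (m0 ⊗ m1) ⊗ m2));
  [mlin | mlin | move=> n h].
rewrite ind_coactE /sw2 !tsum_tsum; [| mlin | mlin].
rewrite -[tsum (comul h)]/(sw2 h).
under eq_sw => a b do [rewrite tsum_pure; last by mlin].
under [RHS]eq_sw => a b do [rewrite tsum_pure; last by mlin].
rewrite -/(sw2 _ _) -(sw_coassoc (F := fun a b c => ((n ⊗ a) ⊗ b) ⊗ c)); last by mlin.
apply: eq_sw => a b; rewrite ind_coactE.
by rewrite (lin_swE (f := fun y => y ⊗ b)); last by mlin.
Qed.

Lemma ind_coact_counit x : \tsum_(m0, m1 <- ind_coact x) counit m1 *: m0 = x.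
Proof.
apply: (@tens_ext _ _ _ _
  (fun x => \tsum_(m0, m1 <- ind_coact x) counit m1 *: m0) (fun x => x));
  [mlin | mlin | move=> n h].
rewrite ind_coactE /sw2 tsum_tsum; last by mlin.
rewrite -(sw_counitr (F := fun h => n ⊗ h)); last by mlin.
by apply: eq_sw => a b; rewrite tsum_pure //; mlin.
Qed.

Lemma ind_coact_ract x r :
  ind_coact (ind_ract x r) = \tsum_(m0, m1 <- ind_coact x) ind_ract m0 r ⊗ m1.
Proof.
apply: (@tens_ext _ _ _ _ (fun x => ind_coact (ind_ract x r))
  (fun x => \tsum_(m0, m1 <- ind_coact x) ind_ract m0 r ⊗ m1));
  [mlin | mlin | move=> n h].
rewrite ind_coactE ind_ractE /sw2 tsum_tsum; last by mlin.
rewrite (lin_tsumE _ _ ind_coact_lin) -[tsum (comul h)]/(sw2 h).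
under eq_sw => a b do rewrite ind_coactE.
under [RHS]eq_sw => a b do [rewrite tsum_pure; last by mlin].
rewrite -(sw_coassoc (F := fun a b c => ((n ◃ cact C a r) ⊗ b) ⊗ c)); last by mlin.
apply: eq_sw => a b; rewrite ind_ractE.
by rewrite (lin_swE (f := fun y => y ⊗ b)); last by mlin.
Qed.

Definition ind_modComodule : modComodule H R :=
  @ModComodule k H R ind_rmodule (mk_linear ind_coact_lin)
    ind_coactA ind_coact_counit ind_coact_ract.

Lemma ind_coact_hact x g : ind_coact (ind_hact x g) =
  \tsum_(m0, m1 <- ind_coact x) \sw_(g1, g2 <- g) ind_hact m0 g1 ⊗ (m1 ∗ g2).
Proof.
apply: (@tens_ext _ _ _ _ (fun x => ind_coact (ind_hact x g))
  (fun x => \tsum_(m0, m1 <- ind_coact x) \sw_(g1, g2 <- g)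
     ind_hact m0 g1 ⊗ (m1 ∗ g2))); [mlin | mlin | move=> n h].
rewrite ind_hactE ind_coactE /sw2 tsum_tsum; last by mlin.
rewrite -![tsum (comul _)]/(sw2 _) (lin_swE _ _ ind_coact_lin).
under eq_sw => a b.
  rewrite (lin_swE _ _ ind_coact_lin).
  under eq_sw => c d.
    rewrite ind_coactE (sw_mul (F := fun x y => n ◃ sigma C a c ⊗ x ⊗ y)); last by mlin.
    over.
  over.
under [RHS]eq_sw => a b.
  rewrite tsum_pure; last by mlin.
  under eq_sw => c d.
    rewrite ind_hactE (lin_swE (f := fun y => y ⊗ (b ∗ d))); last by mlin.
    under eq_sw => a1 a2.
      rewrite (lin_swE (f := fun y => y ⊗ (b ∗ d))); last by mlin.
      over.
    over.
  over.
rewrite (sw_coassoc2 (F := fun a1 c1 a2 c2 b d =>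
  (n ◃ sigma C a1 c1) ⊗ (a2 ∗ c2) ⊗ (b ∗ d))) //; mlin.
Qed.

Lemma ind_hact_ract x g r :
  ind_ract (ind_hact x g) r =
  \sw_(g1, g2 <- g) ind_hact (ind_ract x (cact C g1 r)) g2.
Proof.
apply: (@tens_ext _ _ _ _ (fun x => ind_ract (ind_hact x g) r)
  (fun x => \sw_(g1, g2 <- g) ind_hact (ind_ract x (cact C g1 r)) g2));
  [mlin | mlin | move=> n h].
rewrite ind_hactE (lin_swE (f := fun y => ind_ract y r)); last by mlin.
under eq_sw => a b.
  rewrite (lin_swE (f := fun y => ind_ract y r)); last by mlin.
  under eq_sw => c d.
    rewrite ind_ractE (sw_mul (F := fun x y => (n ◃ sigma C a c ◃ cact C x r) ⊗ y));
      last by mlin.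
    over.
  over.
under [RHS]eq_sw => c d.
  rewrite ind_ractE (lin_swE (f := fun y => ind_hact y d)); last by mlin.
  under eq_sw => a b do rewrite ind_hactE.
  over.
rewrite [RHS]exchange_sw.
rewrite -(sw_coassoc2 (F := fun a1 c1 a2 c2 b d =>
  (n ◃ sigma C a1 c1 ◃ cact C (a2 ∗ c2) r) ⊗ (b ∗ d))); [|mlin|mlin].
transitivity (\sw_(a, b <- h) \sw_(c, d <- g) \sw_(a1, a2 <- a) \sw_(c1, c2 <- c)
  (n ◃ cact C a1 (cact C c1 r) ◃ sigma C a2 c2) ⊗ (b ∗ d)).
  apply: eq_sw => a b; apply: eq_sw => c d.
  under eq_sw => a1 a2 do under eq_sw => c1 c2 do rewrite ractA.
  under [RHS]eq_sw => a1 a2 do under eq_sw => c1 c2 do rewrite ractA.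
  have := congr1 (fun y => (n ◃ y) ⊗ (b ∗ d)) (sigma_cact C a c r).
  rewrite !(lin_swE (f := fun y => (n ◃ y) ⊗ (b ∗ d))); [|mlin|mlin].
  under eq_sw => a1 a2 do [rewrite (lin_swE (f := fun y => (n ◃ y) ⊗ (b ∗ d))); last by mlin].
  move=> ->; apply: eq_sw => a1 a2.
  by rewrite (lin_swE (f := fun y => (n ◃ y) ⊗ (b ∗ d))); last by mlin.
rewrite (sw_coassoc2 (F := fun a1 c1 a2 c2 b d =>
  (n ◃ cact C a1 (cact C c1 r) ◃ sigma C a2 c2) ⊗ (b ∗ d))) //; mlin.
Qed.

Lemma ind_hact1 x : ind_hact x bone = x.
Proof.
apply: (@tens_ext _ _ _ _ (fun x => ind_hact x bone) (fun x => x));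
  [mlin | mlin | move=> n h].
rewrite ind_hactE -(sw_counitl (F := fun h => n ⊗ h)); last by mlin.
apply: eq_sw => a b; rewrite {1}/sw2 comul1 tsum_pure; last by mlin.
rewrite sigma1r bmul1r.
case: (is_lin_additive (f := fun y => (n ◃ y) ⊗ b)) => [|_ _ ->]; first by mlin.
by rewrite ract1.
Qed.



(* sigma(h_1, g_1) sigma(h_2 g_2, l) *)
Let E (h g l : H) : R :=
  \sw_(h1, h2 <- h) \sw_(g1, g2 <- g) sigma C h1 g1 ∙ sigma C (h2 ∗ g2) l.

Lemma E_trilin : trilin E.
Proof. by rewrite /E; mlin. Qed.
Hint Resolve E_trilin : multilinear.

Lemma ind_hact2E n h g l :
  ind_hact (ind_hact (n ⊗ h) g) l =
  \sw_(a, b <- h) \sw_(c, d <- g) \sw_(e, f <- l)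
    (n ◃ E a c e) ⊗ ((b ∗ d) ∗ f).
Proof.
rewrite ind_hactE (lin_swE (f := fun y => ind_hact y l)); last by mlin.
under eq_sw => a b.
  rewrite (lin_swE (f := fun y => ind_hact y l)); last by mlin.
  under eq_sw => c d.
    rewrite ind_hactE (sw_mul (F := fun x y => \sw_(e, f <- l)
      (n ◃ sigma C a c ◃ sigma C x e) ⊗ (y ∗ f))); last by mlin.
    over.
  over.
rewrite -(sw_coassoc2 (F := fun a1 c1 a2 c2 b d => \sw_(e, f <- l)
   (n ◃ sigma C a1 c1 ◃ sigma C (a2 ∗ c2) e) ⊗ ((b ∗ d) ∗ f))); [|mlin|mlin].
apply: eq_sw => a b; apply: eq_sw => c d.
rewrite -exchange_sw_sw; apply: eq_sw => e f.
rewrite (lin_swE (f := fun y => (n ◃ y) ⊗ ((b ∗ d) ∗ f))); last by mlin.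
apply: eq_sw => a1 a2.
rewrite (lin_swE (f := fun y => (n ◃ y) ⊗ ((b ∗ d) ∗ f))); last by mlin.
by apply: eq_sw => c1 c2; rewrite ractA.
Qed.

Lemma E_cocycle h g l :
  \sw_(h1, h2 <- h) \sw_(g1, g2 <- g) \sw_(l1, l2 <- l)
    (cact C h1 (sigma C g1 l1) ∙ sigma C h2 (g2 ∗ l2)) =
  \sw_(h1, h2 <- h) \sw_(g1, g2 <- g) \sw_(l1, l2 <- l)
    omegaV h2 g2 l2 *: E h1 g1 l1.
Proof.
rewrite sigma_cocycle /sw3.
under eq_sw => a x do rewrite exchange_sw.
rewrite -(sw_coassoc2 (F := fun a1 c1 a2 c2 a3 c3 => \sw_(l1, l2 <- l)
  omegaV a3 c3 l2 *: (sigma C a1 c1 ∙ sigma C (a2 ∗ c2) l1))); [|mlin|mlin].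
apply: eq_sw => a b; apply: eq_sw => c d.
rewrite -exchange_sw_sw; apply: eq_sw => e f.
rewrite (lin_swE (f := fun y => omegaV b d f *: y)); last by mlin.
apply: eq_sw => a1 a2.
by rewrite (lin_swE (f := fun y => omegaV b d f *: y)); last by mlin.
Qed.

Lemma omegaV_omega (W : lmodType k) (F : H -> H -> H -> W) h g l : trilin F ->
  \sw_(a, x <- h) \sw_(c, y <- g) \sw_(e, z <- l)
  \sw_(a1, a2 <- x) \sw_(c1, c2 <- y) \sw_(e1, e2 <- z)
    omegaV a c e *: (omega a1 c1 e1 *: F a2 c2 e2) = F h g l.
Proof.
move=> FT; rewrite -(sw_coassoc3 (F := fun a c e a1 c1 e1 a2 c2 e2 =>
  omegaV a c e *: (omega a1 c1 e1 *: F a2 c2 e2))); [|mlin|mlin|mlin].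
transitivity (\sw_(a, x <- h) \sw_(c, y <- g) \sw_(e, z <- l)
   counit a *: (counit c *: (counit e *: F x y z))).
  apply: eq_sw => a x; apply: eq_sw => c y; apply: eq_sw => e z.
  rewrite !scalerA -omegaVl /sw2 /tsum !scaler_suml; apply: eq_bigr => p _.
  rewrite !scaler_suml; apply: eq_bigr => q _.
  rewrite !scaler_suml; apply: eq_bigr => r _.
  by rewrite scalerA.
rewrite -(sw_counitl (F := fun x => F x g l)); last by mlin.
apply: eq_sw => a x; rewrite -(sw_counitl (F := fun y => F x y l)); last by mlin.
rewrite (lin_swE (f := fun y => counit a *: y)); last by mlin.
apply: eq_sw => c y; rewrite -(sw_counitl (F := fun z => F x y z)); last by mlin.
by rewrite (lin_swE (f := fun z => counit a *: (counit c *: z))); last by mlin.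
Qed.

Lemma ind_hactA x g l : ind_hact (ind_hact x g) l =
  \tsum_(m0, m1 <- ind_coact x) \sw_(g1, g2, g3 <- g) \sw_(l1, l2, l3 <- l)
    omega m1 g3 l3 *: ind_hact (ind_ract m0 (sigma C g1 l1)) (g2 ∗ l2).
Proof.
apply: (@tens_ext _ _ _ _ (fun x => ind_hact (ind_hact x g) l)
  (fun x => \tsum_(m0, m1 <- ind_coact x) \sw_(g1, g2, g3 <- g)
     \sw_(l1, l2, l3 <- l)
     omega m1 g3 l3 *: ind_hact (ind_ract m0 (sigma C g1 l1)) (g2 ∗ l2)));
  [mlin | mlin | move=> n h].
rewrite ind_hact2E ind_coactE {4}/sw2 tsum_tsum; last by mlin.
rewrite -[tsum (comul h)]/(sw2 h).
under [RHS]eq_sw => a b do [rewrite tsum_pure; last by mlin].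
rewrite exchange_sw3.
under [RHS]eq_sw3 => g1 g2 g3 do rewrite exchange_sw3.
pose P (a1 g1 l1 a2 g2 l2 a3 g3 l3 a4 g4 l4 : H) : N ⊗ H := omega a4 g4 l4 *:
  ((n ◃ cact C a1 (sigma C g1 l1) ◃ sigma C a2 (g2 ∗ l2)) ⊗ (a3 ∗ (g3 ∗ l3))).
transitivity (\sw_(g1, g2, g3 <- g) \sw_(l1, l2, l3 <- l)
  \sw_(c1, c2 <- g2) \sw_(e1, e2 <- l2)
  sw22 h (fun a1 a2 a3 a4 => P a1 g1 l1 a2 c1 e1 a3 c2 e2 a4 g3 l3)); last first.
  apply: eq_sw3 => g1 g2 g3; apply: eq_sw3 => l1 l2 l3.
  under eq_sw => c1 c2 do rewrite -exchange_sw22.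
  rewrite -exchange_sw22 -sw22_mid; [|rewrite /P; mlin|rewrite /P; mlin].
  apply: eq_sw => a b; rewrite ind_ractE.
  rewrite (lin_swE (f := fun y => omega b g3 l3 *: ind_hact y (g2 ∗ l2))); last by mlin.
  apply: eq_sw => a1 a2; rewrite ind_hactE.
  rewrite (lin_swE (f := fun y => omega b g3 l3 *: y)); last by mlin.
  apply: eq_sw => a3 a4; rewrite (sw_mul (F := fun x y =>
    (n ◃ cact C a1 (sigma C g1 l1) ◃ sigma C a3 x) ⊗ (a4 ∗ y))); last by mlin.
  rewrite (lin_swE (f := fun y => omega b g3 l3 *: y)); last by mlin.
  apply: eq_sw => c1 c2.
  by rewrite (lin_swE (f := fun y => omega b g3 l3 *: y)); last by mlin.
transitivity (sw22 g (fun g1 g2 g3 g4 => sw22 l (fun l1 l2 l3 l4 =>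
  sw22 h (fun a1 a2 a3 a4 => P a1 g1 l1 a2 g2 l2 a3 g3 l3 a4 g4 l4)))); last first.
  rewrite -sw22_midr; [|rewrite /P /sw22; mlin|rewrite /P /sw22; mlin].
  apply: eq_sw3 => g1 g2 g3.
  rewrite -exchange_sw3; apply: eq_sw => c1 c2.
  by rewrite -sw22_midr; [|rewrite /P /sw22; mlin|rewrite /P /sw22; mlin].
transitivity (\sw_(a, b <- h) \sw_(c, d <- g) \sw_(e, f <- l)
  \sw_(a1, a2 <- a) \sw_(c1, c2 <- c) \sw_(e1, e2 <- e)
  \sw_(b1, b2 <- b) \sw_(d1, d2 <- d) \sw_(f1, f2 <- f)
  P a1 c1 e1 a2 c2 e2 b1 d1 f1 b2 d2 f2); last first.
  rewrite exchange_sw_sw /sw22; apply: eq_sw => c d.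
  transitivity (\sw_(e, f <- l) \sw_(c1, c2 <- c) \sw_(e1, e2 <- e)
    \sw_(d1, d2 <- d) \sw_(f1, f2 <- f) \sw_(a, b <- h)
    \sw_(a1, a2 <- a) \sw_(b1, b2 <- b)
    P a1 c1 e1 a2 c2 e2 b1 d1 f1 b2 d2 f2).
    apply: eq_sw => e f.
    under eq_sw => a b do rewrite exchange_sw_sw.
    rewrite exchange_sw_sw; apply: eq_sw => c1 c2; apply: eq_sw => e1 e2.
    under eq_sw => a b do under eq_sw => a1 a2 do rewrite exchange_sw_sw.
    under eq_sw => a b do rewrite exchange_sw_sw.
    by rewrite exchange_sw_sw.
  under [RHS]eq_sw => c1 c2 do rewrite exchange_sw.
  rewrite [RHS]exchange_sw; apply: eq_sw => e f; apply: eq_sw => c1 c2.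
  by rewrite [RHS]exchange_sw.
transitivity (\sw_(a, b <- h) \sw_(c, d <- g) \sw_(e, f <- l)
  \sw_(a1, a2 <- a) \sw_(c1, c2 <- c) \sw_(e1, e2 <- e)
  \sw_(b1, b2 <- b) \sw_(d1, d2 <- d) \sw_(f1, f2 <- f)
  omegaV a2 c2 e2 *: (omega b1 d1 f1 *:
     ((n ◃ E a1 c1 e1) ⊗ ((b2 ∗ d2) ∗ f2)))).
  rewrite (sw_coassoc3 (F := fun a1 c1 e1 a2 c2 e2 b d f =>
    \sw_(b1, b2 <- b) \sw_(d1, d2 <- d) \sw_(f1, f2 <- f)
    omegaV a2 c2 e2 *: (omega b1 d1 f1 *:
     ((n ◃ E a1 c1 e1) ⊗ ((b2 ∗ d2) ∗ f2)))));
    [|mlin|mlin|mlin].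
  apply: eq_sw => a b; apply: eq_sw => c d; apply: eq_sw => e f.
  by rewrite (omegaV_omega (F := fun x y z => (n ◃ E a c e) ⊗ ((x ∗ y) ∗ z))) //; mlin.
apply: eq_sw => a b; apply: eq_sw => c d; apply: eq_sw => e f.
pose Q (r : R) (y : H) : N ⊗ H := (n ◃ r) ⊗ y.
have QB : bilin Q by rewrite /Q; mlin.
have QE F G : Q (\sw_(a1, a2 <- a) \sw_(c1, c2 <- c) \sw_(e1, e2 <- e)
      F a1 a2 c1 c2 e1 e2)
    (\sw_(b1, b2 <- b) \sw_(d1, d2 <- d) \sw_(f1, f2 <- f)
      G b1 b2 d1 d2 f1 f2) =
    \sw_(a1, a2 <- a) \sw_(c1, c2 <- c) \sw_(e1, e2 <- e)
    \sw_(b1, b2 <- b) \sw_(d1, d2 <- d) \sw_(f1, f2 <- f)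
      Q (F a1 a2 c1 c2 e1 e2) (G b1 b2 d1 d2 f1 f2).
  case: QB => QL QR.
  rewrite (lin_swE _ _ (QL _)); apply: eq_sw => a1 a2.
  rewrite (lin_swE _ _ (QL _)); apply: eq_sw => c1 c2.
  rewrite (lin_swE _ _ (QL _)); apply: eq_sw => e1 e2.
  rewrite (lin_swE _ _ (QR _)); apply: eq_sw => b1 b2.
  rewrite (lin_swE _ _ (QR _)); apply: eq_sw => d1 d2.
  by rewrite (lin_swE _ _ (QR _)).
have := QE (fun a1 a2 c1 c2 e1 e2 =>
    cact C a1 (sigma C c1 e1) ∙ sigma C a2 (c2 ∗ e2))
  (fun b1 b2 d1 d2 f1 f2 => omega b2 d2 f2 *: (b1 ∗ (d1 ∗ f1))).
rewrite E_cocycle bmulA.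
rewrite (QE (fun a1 a2 c1 c2 e1 e2 => omegaV a2 c2 e2 *: E a1 c1 e1)
  (fun b1 b2 d1 d2 f1 f2 => omega b1 d1 f1 *: ((b2 ∗ d2) ∗ f2))) => QEE.
have QZ s t r y : Q (s *: r) (t *: y) = s *: (t *: Q r y).
  case: QB => QL QR.
  case: (is_lin_additive (QL (t *: y))) => _ _ ->.
  by case: (is_lin_additive (QR r)) => _ _ ->.
have QZ1 t r y : Q r (t *: y) = t *: Q r y.
  by case: QB => QL QR; case: (is_lin_additive (QR r)) => _ _ ->.
transitivity (\sw_(a1, a2 <- a) \sw_(c1, c2 <- c) \sw_(e1, e2 <- e)
    \sw_(b1, b2 <- b) \sw_(d1, d2 <- d) \sw_(f1, f2 <- f)
      Q (omegaV a2 c2 e2 *: E a1 c1 e1) (omega b1 d1 f1 *: ((b2 ∗ d2) ∗ f2))).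
  by do 6!apply: eq_sw => ? ?; rewrite QZ.
rewrite QEE; do 6!apply: eq_sw => ? ?.
by rewrite QZ1 /Q /P ractA.
Qed.

Definition ind_module : coquasiHopfModule C :=
  @CoquasiHopfModule k H R C ind_modComodule ind_hact ind_hact_bilin
    ind_coact_hact ind_hact_ract ind_hactA ind_hact1.
End InducedModule.

Lemma linear_ext (k : fieldType) (U V : lmodType k) (f g : {linear U -> V}) :
  f =1 g -> f = g.
Proof.
case: f => f [[fD] [fZ]]; case: g => g [[gD] [gZ]] /= /funext fg.
by move: fD fZ; rewrite fg => fD fZ; congr GRing.Linear.Pack; congr GRing.Linear.Class;
  [congr Algebra.isNmodMorphism.Axioms_ | congr GRing.isScalable.Axioms_];
  apply: Prop_irrelevance.
Qed.

Record rmodHom (k : fieldType) (R : algebra k) (M N : rightModule R) :=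
  RmodHom {
  rmod_hom :> {linear M -> N};
  rmod_hom_ract : forall m r, rmod_hom (m ◃ r) = rmod_hom m ◃ r }.

Record chmHom (k : fieldType) (H : coquasiBialgebra k) (R : algebra k)
    (C : crossedSystem H R) (M N : coquasiHopfModule C) := ChmHom {
  chm_hom :> rmodHom M N;
  chm_hom_coact : forall m,
    coact (chm_hom m) = \tsum_(m0, m1 <- coact m) chm_hom m0 ⊗ m1;
  chm_hom_hact : forall m h, chm_hom (m ∘ h) = chm_hom m ∘ h }.

Lemma rmodHom_ext k (R : algebra k) (M N : rightModule R) (f g : rmodHom M N) :
  f =1 g -> f = g.
Proof.
case: f => f fR; case: g => g gR /= /linear_ext fg.
by move: fR; rewrite fg => fR; congr RmodHom; apply: Prop_irrelevance.
Qed.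

Lemma chmHom_ext k (H : coquasiBialgebra k) (R : algebra k)
    (C : crossedSystem H R) (M N : coquasiHopfModule C) (f g : chmHom M N) :
  f =1 g -> f = g.
Proof.
case: f => f fH fR; case: g => g gH gR /= /rmodHom_ext fg.
by move: fH fR; rewrite fg => fH fR; congr ChmHom; apply: Prop_irrelevance.
Qed.

Section ModuleCategories.
Variables (k : fieldType) (H : coquasiBialgebra k) (R : algebra k).
Variable (C : crossedSystem H R).

Definition rmod_id (M : rightModule R) : rmodHom M M.
Proof. by exists (idfun : {linear M -> M}). Defined.

Definition rmod_comp (M N P : rightModule R) (f : rmodHom N P)
  (g : rmodHom M N) : rmodHom M P.
Proof. by exists (f \o g) => m r; rewrite /= !rmod_hom_ract. Defined.

Definition rmodCat : category.
Proof.
by exists (rightModule R) (@rmodHom k R) rmod_id rmod_comp => *; exact: rmodHom_ext.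
Defined.

Definition chm_id (M : coquasiHopfModule C) : chmHom M M.
Proof. by exists (rmod_id M) => // m; rewrite tsum_id. Defined.

Definition chm_comp (M N P : coquasiHopfModule C) (f : chmHom N P)
  (g : chmHom M N) : chmHom M P.
Proof.
exists (rmod_comp f g) => [m|m h] /=; last by rewrite !chm_hom_hact.
rewrite !chm_hom_coact tsum_tsum; last by mlin.
by apply: eq_tsum => m0 m1; rewrite tsum_pure //; mlin.
Defined.

Definition coquasiHopfModCat : category.
Proof.
by exists (coquasiHopfModule C) (@chmHom k H R C) chm_id chm_comp => *;
   exact: chmHom_ext.
Defined.

Section InducedMap.
Variables (M N : rightModule R) (f : rmodHom M N).

Definition ind_map (x : M ⊗ H) : N ⊗ H := \tsum_(m, h <- x) f m ⊗ h.

Lemma ind_map_lin : is_lin ind_map.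
Proof. by rewrite /ind_map; mlin. Qed.
Hint Resolve ind_map_lin ind_ract_bilin ind_coact_lin ind_hact_bilin : multilinear.

Lemma ind_mapE m h : ind_map (m ⊗ h) = f m ⊗ h.
Proof. by rewrite /ind_map tsum_pure //; mlin. Qed.

Lemma ind_map_ract x r : ind_map (ind_ract C x r) = ind_ract C (ind_map x) r.
Proof.
apply: (@tens_ext _ _ _ _ (fun x => ind_map (ind_ract C x r))
  (fun x => ind_ract C (ind_map x) r)); [mlin | mlin | move=> m h].
rewrite ind_mapE !ind_ractE (lin_swE _ _ ind_map_lin); apply: eq_sw => a b.
by rewrite ind_mapE rmod_hom_ract.
Qed.

Lemma ind_map_coact x :
  ind_coact (ind_map x) = \tsum_(m0, m1 <- ind_coact x) ind_map m0 ⊗ m1.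
Proof.
apply: (@tens_ext _ _ _ _ (fun x => ind_coact (ind_map x))
  (fun x => \tsum_(m0, m1 <- ind_coact x) ind_map m0 ⊗ m1));
  [mlin | mlin | move=> m h].
rewrite ind_mapE !ind_coactE {2}/sw2 tsum_tsum; last by mlin.
by apply: eq_sw => a b; rewrite tsum_pure ?ind_mapE //; mlin.
Qed.

Lemma ind_map_hact x g : ind_map (ind_hact C x g) = ind_hact C (ind_map x) g.
Proof.
apply: (@tens_ext _ _ _ _ (fun x => ind_map (ind_hact C x g))
  (fun x => ind_hact C (ind_map x) g)); [mlin | mlin | move=> m h].
rewrite ind_mapE !ind_hactE (lin_swE _ _ ind_map_lin); apply: eq_sw => a b.
rewrite (lin_swE _ _ ind_map_lin); apply: eq_sw => c d.
by rewrite ind_mapE rmod_hom_ract.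
Qed.

Definition ind_hom : chmHom (ind_module C M) (ind_module C N).
Proof.
exists (@RmodHom _ _ (ind_module C M) (ind_module C N)
          (mk_linear ind_map_lin) ind_map_ract).
- exact: ind_map_coact.
- exact: ind_map_hact.
Defined.
End InducedMap.

Definition tensorH : functor rmodCat coquasiHopfModCat.
Proof.
exists (ind_module C : rmodCat -> coquasiHopfModCat) ind_hom.
- by move=> M; apply: chmHom_ext => x; apply: tsum_id.
- move=> M N P f g; apply: chmHom_ext => x /=.
  rewrite /ind_map tsum_tsum; last by mlin.
  by apply: eq_tsum => m h; rewrite tsum_pure //; mlin.
Defined.
End ModuleCategories.

Section Coinvariants.
Variables (k : fieldType) (H : coquasiBialgebra k) (R : algebra k).
Variable (C : crossedSystem H R).

Section CoinvariantModule.
Variable (M : modComodule H R).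

Definition is_coinv : {pred M} := fun m => coact m == m ⊗ bone.

Lemma is_coinv_submod : GRing.subsemimod_closed is_coinv.
Proof.
have inE m : (m \in is_coinv) = (coact m == m ⊗ bone) by [].
case: (is_lin_additive (f := fun m : M => m ⊗ (bone : H))) => [|p0 pD pZ].
  by mlin.
split; [split|].
- by rewrite inE linear0 p0.
- by move=> x y; rewrite !inE => /eqP ex /eqP ey; rewrite linearD ex ey pD.
- by move=> a x; rewrite !inE => /eqP ex; rewrite linearZ ex pZ.
Qed.
HB.instance Definition _ := GRing.isSubmodClosed.Build k M is_coinv is_coinv_submod.

Record coinv := Coinv { coinv_val :> M; _ : coinv_val \in is_coinv }.
HB.instance Definition _ := [isSub for coinv_val].
HB.instance Definition _ := [Choice of coinv by <:].
HB.instance Definition _ := [SubChoice_isSubLmodule of coinv by <:].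

Lemma coinvP (m : coinv) : coact (val m) = val m ⊗ bone.
Proof. exact/eqP/(valP m). Qed.

Lemma coinv_ract_subproof (m : coinv) r : val m ◃ r \in is_coinv.
Proof. by apply/eqP; rewrite coact_ract coinvP tsum_pure //; mlin. Qed.

Definition coinv_ract (m : coinv) r : coinv := Coinv (coinv_ract_subproof m r).

Lemma coinv_ract_bilin : bilin coinv_ract.
Proof.
case: (ract_bilin M) => rl rr.
by split=> [r a x y|x a r s]; apply: val_inj; [apply: rl | apply: rr].
Qed.
Lemma coinv_ractA m r s :
  coinv_ract (coinv_ract m r) s = coinv_ract m (r ∙ s).
Proof. by apply: val_inj; apply: ractA. Qed.
Lemma coinv_ract1 m : coinv_ract m aone = m.
Proof. by apply: val_inj; apply: ract1. Qed.

Definition coinv_module : rightModule R :=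
  RightModule coinv_ract_bilin coinv_ractA coinv_ract1.
End CoinvariantModule.

Section CoinvariantMap.
Variables (M N : coquasiHopfModule C) (f : chmHom M N).

Lemma coinv_map_subproof (m : coinv M) : f (val m) \in @is_coinv N.
Proof. by apply/eqP; rewrite chm_hom_coact coinvP tsum_pure //; mlin. Qed.

Definition coinv_map (m : coinv M) : coinv N := Coinv (coinv_map_subproof m).

Lemma coinv_map_lin : is_lin coinv_map.
Proof. by move=> a x y; apply: val_inj; apply: linearP. Qed.

Lemma coinv_map_ract m r :
  coinv_map (coinv_ract m r) = coinv_ract (coinv_map m) r.
Proof. by apply: val_inj; apply: rmod_hom_ract. Qed.

Definition coinv_hom : rmodHom (coinv_module M) (coinv_module N) :=
  @RmodHom _ _ (coinv_module M) (coinv_module N)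
    (mk_linear coinv_map_lin) coinv_map_ract.
End CoinvariantMap.

Definition coinvariants : functor (coquasiHopfModCat C) (rmodCat R).
Proof.
exists (fun M : coquasiHopfModCat C => coinv_module M : rmodCat R) coinv_hom.
- by move=> M; apply: rmodHom_ext => x; apply: val_inj.
- by move=> M N P f g; apply: rmodHom_ext => x; apply: val_inj.
Defined.
End Coinvariants.

(* Main.v *)
Require Import Defs.
From HB Require Import structures.
From mathcomp Require Import all_boot all_order all_algebra.

Set Implicit Arguments.
Unset Strict Implicit.
Unset Printing Implicit Defensive.

Import GRing.Theory.
Local Open Scope ring_scope.

(** For a right R-module N, every coinvariant of N ⊗ H has the form n ⊗ 1: apply
id ⊗ ε ⊗ id to the coinvariance equation.  So N is naturally isomorphic to the
coinvariants of N ⊗ H ([coinv_unitK], [coinv_unit_invK]).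

In the other direction, the comparison map M^coH ⊗ H -> M is n ⊗ h |-> n ∘ h
([hact_hom]); it respects the action of H because ω(1, h, g) = ε(h) ε(g)
([omega_unitl]).  Its inverse sends m to π(m_0) ⊗ m_1, where, with τ = σ^{-1},
<<
  π(m) = [m_0 τ(S(m_3), m_5)] ∘ S(m_2) β(m_1) α(m_4).
>>
When ω, α and β are trivial this is m |-> m_0 γ^{-1}(m_1), where γ^{-1} is the
convolution inverse of the canonical cleaving map γ of the crossed product of
R by H.  Three facts make it work.

- π(m) is coinvariant ([coact_proj]): its coaction contains m_1 β(m_2) S(m_3),
  which collapses to β(m_1) 1.

- π(n ∘ h) = ε(h) n for n coinvariant ([proj_hact]).  After collapsing
  h β(h) S(h) this becomes the identity
<<
  [h_1 · τ(S(h_5), h_7)] σ(h_2, S(h_4)) β(h_3) α(h_6) = ε(h) 1_R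
>>
  ([zigzag_tau_sigma]).  To prove it, use τ to move the factor h · σ(g, l) of
  the cocycle condition to the other side ([sigma_cocycle_inv]), and evaluate
  the result at h_1, β(h_2) S(h_3), α(h_4) h_5: one side collapses to the left
  side above, the other to ω(h_1, S(h_3), h_5) β(h_2) α(h_4) = ε(h).

- π(m_0) ∘ m_1 = m ([sw_proj_hact]): quasi-associativity of the action brings
  in a factor σ that cancels τ and a factor ω(m_1, S(m_3), m_5); S(h) α(h) h
  collapses, and the same axiom for ω concludes.

All these computations evaluate trilinear functions at
h_1 ⊗ β(h_2) S(h_3) ⊗ α(h_4) h_5, an operation called [zigzag] below. *)

(** * Convolution and the inverted cocycle identity *)

(* [mlin] expects an abstraction: a partial application is eta-expanded first *)
Ltac mlin_eta :=
  lazymatch goal with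
  | |- @is_lin ?k ?U ?V ?f => change (@is_lin k U V (fun x => f x)); mlin
  | |- _ => mlin
  end.

Lemma linZ (k : fieldType) (U V : lmodType k) (f : U -> V) a x :
  is_lin f -> f (a *: x) = a *: f x.
Proof. by case/is_lin_additive=> _ _ ->. Qed.

Section LinearSums.
Variables (k : fieldType) (H : coquasiBialgebra k) (X Y : lmodType k).
Variables (f : X -> Y) (fL : is_lin f).

Lemma lin_sw2E (h g : H) (F : H -> H -> H -> H -> X) :
  f (\sw_(h1, h2 <- h) \sw_(g1, g2 <- g) F h1 h2 g1 g2) =
  \sw_(h1, h2 <- h) \sw_(g1, g2 <- g) f (F h1 h2 g1 g2).
Proof. by rewrite lin_swE //; apply: eq_sw => h1 h2; rewrite lin_swE. Qed.

Lemma lin_sw3E (h g l : H) (F : H -> H -> H -> H -> H -> H -> X) :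
  f (\sw_(h1, h2 <- h) \sw_(g1, g2 <- g) \sw_(l1, l2 <- l) F h1 h2 g1 g2 l1 l2) =
  \sw_(h1, h2 <- h) \sw_(g1, g2 <- g) \sw_(l1, l2 <- l) f (F h1 h2 g1 g2 l1 l2).
Proof. by rewrite lin_swE //; apply: eq_sw => h1 h2; rewrite lin_sw2E. Qed.
End LinearSums.

Section CounitSums.
Variables (k : fieldType) (H : coquasiBialgebra k) (W : lmodType k).

Lemma sw_counitl2 (F : H -> H -> W) h g : bilin F ->
  \sw_(h1, h2 <- h) \sw_(g1, g2 <- g) (counit h1 * counit g1) *: F h2 g2 = F h g.
Proof.
move=> FB; rewrite -[RHS](sw_counitl (F := fun x => F x g)); last by mlin.
apply: eq_sw => h1 h2; rewrite -[in RHS](sw_counitl (F := fun y => F h2 y)); last by mlin.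
rewrite (lin_swE (f := fun y => counit h1 *: y)); last by mlin.
by apply: eq_sw => g1 g2; rewrite scalerA.
Qed.

Lemma sw_counitl3 (F : H -> H -> H -> W) h g l : trilin F ->
  \sw_(h1, h2 <- h) \sw_(g1, g2 <- g) \sw_(l1, l2 <- l)
    (counit h1 * counit g1 * counit l1) *: F h2 g2 l2 = F h g l.
Proof.
move=> FT; rewrite -[RHS](sw_counitl2 (F := fun x y => F x y l)); last by mlin.
apply: eq_sw => h1 h2; apply: eq_sw => g1 g2.
rewrite -[in RHS](sw_counitl (F := fun y => F h2 g2 y)); last by mlin.
rewrite (lin_swE (f := fun y => (counit h1 * counit g1) *: y)); last by mlin.
by apply: eq_sw => l1 l2; rewrite scalerA.
Qed.

Lemma sw_counitr2 (F : H -> H -> W) h g : bilin F ->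
  \sw_(h1, h2 <- h) \sw_(g1, g2 <- g) (counit h2 * counit g2) *: F h1 g1 = F h g.
Proof.
move=> FB; rewrite -[RHS](sw_counitr (F := fun x => F x g)); last by mlin.
apply: eq_sw => h1 h2; rewrite -[in RHS](sw_counitr (F := fun y => F h1 y)); last by mlin.
rewrite (lin_swE (f := fun y => counit h2 *: y)); last by mlin.
by apply: eq_sw => g1 g2; rewrite scalerA.
Qed.

Lemma sw_counitr3 (F : H -> H -> H -> W) h g l : trilin F ->
  \sw_(h1, h2 <- h) \sw_(g1, g2 <- g) \sw_(l1, l2 <- l)
    (counit h2 * counit g2 * counit l2) *: F h1 g1 l1 = F h g l.
Proof.
move=> FT; rewrite -[RHS](sw_counitr2 (F := fun x y => F x y l)); last by mlin.
apply: eq_sw => h1 h2; apply: eq_sw => g1 g2.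
rewrite -[in RHS](sw_counitr (F := fun y => F h1 g1 y)); last by mlin.
rewrite (lin_swE (f := fun y => (counit h2 * counit g2) *: y)); last by mlin.
by apply: eq_sw => l1 l2; rewrite scalerA.
Qed.
End CounitSums.

Section Convolution.
Variables (k : fieldType) (H : coquasiBialgebra k) (R : algebra k).
Implicit Types f p q : H -> H -> H -> R.

(** The product of the convolution algebra Hom(H ⊗ H ⊗ H, R). *)
Definition conv3 f p (h g l : H) : R :=
  \sw_(h1, h2 <- h) \sw_(g1, g2 <- g) \sw_(l1, l2 <- l) (f h1 g1 l1 ∙ p h2 g2 l2).

Definition conv3_one (h g l : H) : R := (counit h * counit g * counit l) *: aone.

Lemma eq_conv3 f f' p p' h g l :
  (forall h g l, f h g l = f' h g l) -> (forall h g l, p h g l = p' h g l) ->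
  conv3 f p h g l = conv3 f' p' h g l.
Proof. by move=> ff' pp'; do 3!apply: eq_sw => ? ?; rewrite ff' pp'. Qed.

Lemma conv3A f p q h g l : trilin f -> trilin p -> trilin q ->
  conv3 (conv3 f p) q h g l = conv3 f (conv3 p q) h g l.
Proof.
move=> fT pT qT; rewrite /conv3.
transitivity (\sw_(a, b <- h) \sw_(c, d <- g) \sw_(e, x <- l)
  \sw_(a1, a2 <- a) \sw_(c1, c2 <- c) \sw_(e1, e2 <- e)
   (f a1 c1 e1 ∙ p a2 c2 e2 ∙ q b d x)).
  do 3!apply: eq_sw => ? ?.
  by rewrite (lin_sw3E (f := fun y => y ∙ _)) //; mlin_eta.
rewrite (sw_coassoc3 (F := fun a1 c1 e1 a2 c2 e2 b d x =>
  f a1 c1 e1 ∙ p a2 c2 e2 ∙ q b d x)); [|mlin_eta|mlin_eta|mlin_eta].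
do 3!apply: eq_sw => ? ?; rewrite lin_sw3E; last by mlin_eta.
by do 3!apply: eq_sw => ? ?; rewrite amulA.
Qed.

Lemma conv3_1f f h g l : trilin f -> conv3 conv3_one f h g l = f h g l.
Proof.
move=> fT; rewrite -[RHS]sw_counitl3 //; do 3!apply: eq_sw => ? ?.
by rewrite (linZ _ _ (f := fun y => y ∙ _)) ?amul1l //; mlin_eta.
Qed.

Lemma conv3_f1 f h g l : trilin f -> conv3 f conv3_one h g l = f h g l.
Proof.
move=> fT; rewrite -[RHS]sw_counitr3 //; do 3!apply: eq_sw => ? ?.
by rewrite linZ ?amul1r //; mlin_eta.
Qed.
End Convolution.

Section InvertedCocycle.
Variables (k : fieldType) (H : coquasiBialgebra k) (R : algebra k).
Variables (C : crossedSystem H R) (tau : H -> H -> R).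
Hypothesis tauB : bilin tau.
Hypothesis tau_sigma : forall h g,
  \sw_(h1, h2 <- h) \sw_(g1, g2 <- g) (tau h1 g1 ∙ sigma C h2 g2) =
  (counit h * counit g) *: aone.
Hint Resolve tauB : multilinear.

Let A (h g l : H) : R := cact C h (tau g l).
Let B (h g l : H) : R := cact C h (sigma C g l).
Let D (h g l : H) : R := sigma C h (g ∗ l).
Let E (h g l : H) : R :=
  \sw_(h1, h2 <- h) \sw_(g1, g2 <- g) sigma C h1 g1 ∙ sigma C (h2 ∗ g2) l.
Let O (h g l : H) : R := omega h g l *: aone.
Let V (h g l : H) : R := omegaV h g l *: aone.

(** The cocycle condition says B * D = E * ω^{-1} for the convolution product,
with B = h · σ(g, l), D = σ(h, gl) and E = σ(h_1, g_1) σ(h_2 g_2, l).  As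
A = h · τ(g, l) is a left inverse of B, it follows that D * ω = A * E. *)
Lemma sigma_cocycle_inv h g l :
  \sw_(h1, h2 <- h) \sw_(g1, g2 <- g) \sw_(l1, l2 <- l)
    omega h2 g2 l2 *: sigma C h1 (g1 ∗ l1) =
  \sw_(h1, h2 <- h) \sw_(g1, g2 <- g) \sw_(l1, l2 <- l)
    (cact C h1 (tau g1 l1) ∙
     \sw_(x1, x2 <- h2) \sw_(y1, y2 <- g2) sigma C x1 y1 ∙ sigma C (x2 ∗ y2) l2).
Proof.
have AT : trilin A by rewrite /A; mlin_eta.
have BT : trilin B by rewrite /B; mlin_eta.
have DT : trilin D by rewrite /D; mlin_eta.
have ET : trilin E by rewrite /E; mlin_eta.
have OT : trilin O by rewrite /O; mlin_eta.
have VT : trilin V by rewrite /V; mlin_eta.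
have convT f p : trilin f -> trilin p -> trilin (@conv3 _ _ R f p).
  by move=> fT pT; rewrite /conv3; mlin_eta.
(* h · - is multiplicative, so it maps τ * σ = 1 to A * B = 1 *)
have AB x y z : conv3 A B x y z = conv3_one R x y z.
  transitivity (\sw_(x1, x2 <- x) (cact C x1 ((counit y * counit z) *: aone) ∙ cact C x2 aone)).
    rewrite -cactM amul1r -tau_sigma lin_sw2E; last by mlin_eta.
    rewrite /conv3 exchange_sw_sw; do 2!apply: eq_sw => ? ?.
    by rewrite cactM.
  rewrite -cactM amul1r linZ; last by mlin_eta.
  by rewrite cact1 scalerA mulrC /conv3_one mulrA.
have BD x y z : conv3 B D x y z = conv3 E V x y z.
  rewrite /conv3 /B /D E_cocycle; do 3!apply: eq_sw => ? ?.
  by rewrite linZ ?amul1r //; mlin_eta.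
have VO x y z : conv3 V O x y z = conv3_one R x y z.
  rewrite /conv3_one -omegaVl /sw2 /tsum !scaler_suml.
  do 3![apply: eq_bigr => ? _; rewrite ?scaler_suml].
  rewrite /V /O linZ ?amul1r ?scalerA; last by mlin_eta.
  by rewrite mulrC.
rewrite -[RHS]/(conv3 A E h g l); transitivity (conv3 D O h g l).
  by do 3!apply: eq_sw => ? ?; rewrite /O linZ ?amul1r //; mlin_eta.
rewrite -conv3_1f; last exact: convT.
rewrite -(@eq_conv3 _ _ _ (conv3 A B) _ (conv3 D O)) // conv3A //; last exact: convT.
apply: (@eq_conv3 _ _ _ A A) => // x y z; rewrite -conv3A //.
rewrite (@eq_conv3 _ _ _ _ (conv3 E V) _ O) // conv3A //.
by rewrite (@eq_conv3 _ _ _ _ E _ (conv3_one R)) // conv3_f1.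
Qed.
End InvertedCocycle.

(** * Sums along the antipode *)

Section ZigzagDef.
Variables (k : fieldType) (H : coquasiHopf k) (W : lmodType k).

(** The value of F at β(h_1) S(h_2) ⊗ α(h_3) h_4, that is, the part of
[zigzag] that does not involve the first leg of h. *)
Definition zag (h : H) (F : H -> H -> W) : W :=
  \sw_(a, b <- h) beta a *: \sw_(c, d, e <- b) alpha d *: F (antipode c) e.
(** The value of F at h_1 ⊗ β(h_2) S(h_3) ⊗ α(h_4) h_5.  In a dual pair of
comodules β is the coevaluation and α the evaluation, and this is the shape of
the zigzag identity: F = ω gives ε, see [zigzag_omega]. *)
Definition zigzag (h : H) (F : H -> H -> H -> W) : W :=
  \sw_(a, b <- h) zag b (F a).
End ZigzagDef.

Section Zigzag.
Variables (k : fieldType) (H : coquasiHopf k) (W : lmodType k).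

Lemma eq_zag (h : H) (F F' : H -> H -> W) : (forall a b, F a b = F' a b) -> zag h F = zag h F'.
Proof.
by move=> FF'; apply: eq_sw => a b; congr (_ *: _); apply: eq_sw3 => c d e; rewrite FF'.
Qed.

Lemma eq_zigzag (h : H) (F F' : H -> H -> H -> W) :
  (forall a b c, F a b c = F' a b c) -> zigzag h F = zigzag h F'.
Proof. by move=> FF'; apply: eq_sw => a b; apply: eq_zag. Qed.

Lemma zigzag_omega (w : W) (h : H) :
  zigzag h (fun a g l => omega a g l *: w) = counit h *: w.
Proof.
rewrite -omega_antipode /zigzag /zag /sw5 /sw3 /sw2 /tsum scaler_suml.
apply: eq_bigr => p _; rewrite scaler_suml; apply: eq_bigr => q _.
rewrite scaler_suml scaler_sumr; apply: eq_bigr => r _.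
rewrite scaler_suml scaler_sumr; apply: eq_bigr => s _.
by rewrite !scalerA mulrC mulrA.
Qed.

Lemma lin_zagE (X : lmodType k) (f : X -> W) h (F : H -> H -> X) : is_lin f ->
  f (zag h F) = zag h (fun g l => f (F g l)).
Proof.
move=> fL; rewrite lin_swE //; apply: eq_sw => a b; rewrite linZ //.
congr (_ *: _); rewrite /sw3 lin_swE //; apply: eq_sw => c z.
by rewrite lin_swE //; apply: eq_sw => d e; rewrite linZ.
Qed.

Lemma zag_tsum (U V : lmodType k) (t : U ⊗ V) h (F : U -> V -> H -> H -> W) :
  zag h (fun g l => \tsum_(a, b <- t) F a b g l) =
  \tsum_(a, b <- t) zag h (F a b).
Proof.
rewrite /zag /sw3 /sw2 /tsum [RHS]exchange_big; apply: eq_bigr => p _.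
rewrite -scaler_sumr; congr (_ *: _).
rewrite [RHS]exchange_big; apply: eq_bigr => q _.
rewrite [RHS]exchange_big; apply: eq_bigr => r _.
by rewrite scaler_sumr.
Qed.

(** Coassociativity, for the last leg of [zag]. *)
Lemma zag_sw (h : H) (F : H -> H -> H -> W) : trilin F ->
  \sw_(a, b <- h) zag a (fun g l => F g l b) =
  zag h (fun g l => \sw_(l1, l2 <- l) F g l1 l2).
Proof.
move=> FT; rewrite /zag.
rewrite (sw_coassoc (F := fun x y b => beta x *: \sw_(c, d, e <- y)
  alpha d *: F (antipode c) e b)); last by mlin.
apply: eq_sw => x y; rewrite -(lin_swE (f := fun z => beta x *: z)); last by mlin.
congr (_ *: _); rewrite /sw3.
rewrite (sw_coassoc (F := fun c z b => \sw_(d, e <- z) alpha d *: F (antipode c) e b));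
  last by mlin.
apply: eq_sw => c z.
rewrite (sw_coassoc (F := fun d e b => alpha d *: F (antipode c) e b)); last by mlin.
apply: eq_sw => d e; rewrite -(lin_swE (f := fun z => alpha d *: z)) //.
by mlin.
Qed.

(** Of the five legs of h, the middle three combine to M(h_2, h_4) f(h_3), which
collapses to f 1 by the hypothesis on f.  The two antipode axioms are the cases
f = β, M(a, c) = a S(c) and f = α, M(a, c) = S(a) c; in both, S reverses the
order of the legs, which is why the inner legs meet. *)
Lemma sw3_contract (h : H) (f : {scalar H}) (M : H -> H -> H) (G : H -> H -> H -> W) :
  bilin M -> trilin G ->
  (forall x, \sw_(a, b, c <- x) f b *: M a c = f x *: bone) ->
  \sw_(a, b, c <- h) \sw_(a1, a2 <- a) \sw_(c1, c2 <- c)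
    f b *: G a1 c2 (M a2 c1) =
  \sw_(a, b, c <- h) f b *: G a c bone.
Proof.
move=> MB GT fM; rewrite /sw3.
under eq_sw => a y do rewrite exchange_sw.
rewrite (sw_coassoc (F := fun a1 a2 y => \sw_(b, c <- y) \sw_(c1, c2 <- c)
  f b *: G a1 c2 (M a2 c1))); last by mlin.
apply: eq_sw => a1 y.
transitivity (\sw_(a2, z <- y) \sw_(q, c2 <- z) \sw_(b, c1 <- q)
    f b *: G a1 c2 (M a2 c1)).
  apply: eq_sw => a2 z.
  by rewrite (sw_coassoc (F := fun b c1 c2 => f b *: G a1 c2 (M a2 c1))) //; mlin.
rewrite -(sw_coassoc (F := fun a2 q c2 => \sw_(b, c1 <- q) f b *: G a1 c2 (M a2 c1)));
  last by mlin.
apply: eq_sw => z c; rewrite -(linZ _ _ (f := G a1 c)) -?fM; last by mlin_eta.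
rewrite /sw3 lin_swE; last by mlin_eta.
apply: eq_sw => a2 x; rewrite lin_swE; last by mlin_eta.
by apply: eq_sw => b c1; rewrite linZ //; mlin_eta.
Qed.

(** The legs of h grouped as (h_1, h_2, h_3), (h_4, h_5), which isolates the
part on which β acts. *)
Lemma zigzag_nestl (h : H) (F : H -> H -> H -> W) : trilin F ->
  zigzag h F = \sw_(x, y <- h) \sw_(a, b, c <- x)
    beta b *: \sw_(d, e <- y) alpha d *: F a (antipode c) e.
Proof.
move=> FT; rewrite /zigzag /zag.
transitivity (\sw_(a, z <- h) \sw_(b, t <- z) \sw_(c, y <- t)
    beta b *: \sw_(d, e <- y) alpha d *: F a (antipode c) e).
  apply: eq_sw => a z; apply: eq_sw => b t.
  by rewrite /sw3 lin_swE //; mlin_eta.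
rewrite /sw3 [RHS](sw_coassoc (F := fun a z y => \sw_(b, c <- z)
  beta b *: \sw_(d, e <- y) alpha d *: F a (antipode c) e)); last by mlin.
apply: eq_sw => a z.
by rewrite (sw_coassoc (F := fun b c y =>
  beta b *: \sw_(d, e <- y) alpha d *: F a (antipode c) e)) //; mlin.
Qed.

(** The axiom h_1 β(h_2) S(h_3) = β(h) 1, in the form used for [zigzag]: a product
a_2 g_2 of the first two arguments may be replaced by 1. *)
Lemma zigzag_beta (h : H) (F : H -> H -> H -> H -> W) :
  (forall l, trilin (F l)) -> (forall a b c, is_lin (fun l => F l a b c)) ->
  zigzag h (fun a g l =>
    \sw_(a1, a2 <- a) \sw_(g1, g2 <- g) F l a1 g1 (a2 ∗ g2)) =
  zigzag h (fun a g l => F l a g bone).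
Proof.
move=> FT FL.
rewrite !zigzag_nestl; first last.
- split=> u v; last 1 first.
    by do 2!apply: lin_tsumr => ? ?.
  + by mlin.
  + by mlin.
- by split=> u v; [mlin | mlin | apply: FL].
apply: eq_sw => x y.
pose G a c z : W := \sw_(d, e <- y) alpha d *: F e a (antipode c) z.
have GT : trilin G by rewrite /G; mlin.
rewrite -[RHS](@sw3_contract x beta (fun a c => a ∗ antipode c) G) //; first last.
- exact: antipode_beta.
- by mlin.
apply: eq_sw3 => a b c.
transitivity (beta b *: \sw_(d, e <- y) \sw_(a1, a2 <- a) \sw_(c1, c2 <- c)
    alpha d *: F e a1 (antipode c2) (a2 ∗ antipode c1)).
  congr (_ *: _); apply: eq_sw => d e; rewrite -lin_sw2E; last by mlin_eta.
  congr (_ *: _); apply: eq_sw => a1 a2.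
  rewrite {1}/sw2 comul_antipode tsum_tsum; last by mlin.
  by apply: eq_sw => c1 c2; rewrite tsum_pure //; mlin.
by rewrite exchange_sw_sw lin_sw2E //; mlin_eta.
Qed.

(** The axiom S(h_1) α(h_2) h_3 = α(h) 1: a product g_1 l_1 of the last two
arguments may be replaced by 1. *)
Lemma zigzag_alpha (h : H) (F : H -> H -> H -> H -> W) :
  (forall a, trilin (F a)) -> (forall b c d, is_lin (fun a => F a b c d)) ->
  zigzag h (fun a g l =>
    \sw_(g1, g2 <- g) \sw_(l1, l2 <- l) F a g2 l2 (g1 ∗ l1)) =
  zigzag h (fun a g l => F a g l bone).
Proof.
move=> FT FL; apply: eq_sw => a x; apply: eq_sw => b y; congr (_ *: _).
rewrite -[RHS](@sw3_contract y alpha (fun a c => antipode a ∗ c)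
  (fun g l z => F a (antipode g) l z)); first last.
- exact: antipode_alpha.
- by mlin.
- by mlin.
apply: eq_sw3 => c d e; rewrite {1}/sw2 comul_antipode tsum_tsum; last by mlin.
rewrite -[tsum (comul c)]/(sw2 c) lin_swE; last by mlin_eta.
apply: eq_sw => c1 c2; rewrite tsum_pure; last by mlin.
by rewrite lin_swE //; mlin_eta.
Qed.

Lemma zigzag_counit (h : H) (F : H -> H -> W) : bilin F ->
  zigzag h (fun a g l => counit a *: F g l) = zag h F.
Proof.
move=> FB; rewrite -[RHS](sw_counitl (F := fun b => zag b F)); last by rewrite /zag; mlin.
apply: eq_sw => a b; rewrite (lin_zagE (f := fun x => counit a *: x)) //.
exact: lin_scale (@lin_id _ _).
Qed.
End Zigzag.

(** * Identities for the associator and the cocycle *)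

Section OmegaUnit.
Variables (k : fieldType) (H : coquasiBialgebra k).

Lemma sw_bone (X : lmodType k) (F : H -> H -> X) : bilin F ->
  sw2 bone F = F bone bone.
Proof. by move=> FB; rewrite /sw2 comul1 tsum_pure. Qed.

(** The cocycle condition for ω at (1, 1, h, g) makes f = ω(1, -, -) a convolution
idempotent, f = f * f.  It is invertible, so it is the unit. *)
Lemma omega_unitl (h g : H) : omega bone h g = counit h * counit g.
Proof.
(* values in the regular module, so that the multilinear tools apply *)
pose w : H -> H -> H -> k^o := @omega k H.
have wT : trilin w by apply: omega_trilin.
have ww x y : w bone x y =
    \sw_(x1, x2 <- x) \sw_(y1, y2 <- y) omega bone x1 y1 *: w bone x2 y2.
  have cocycle1 :
      \sw_(h1, h2 <- bone) \sw_(g1, g2 <- bone) \sw_(x1, x2 <- x) \sw_(y1, y2 <- y)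
        omega h1 g1 (x1 ∗ y1) *: w (h2 ∗ g2) x2 y2 =
      \sw_(h1, h2 <- bone) \sw_(g1, g2, g3 <- bone) \sw_(x1, x2, x3 <- x)
      \sw_(y1, y2 <- y)
        (omega g1 x1 y1 * omega h1 (g2 ∗ x2) y2) *: w h2 g3 x3 :=
    omega_cocycle bone bone x y.
  move: cocycle1; rewrite /sw3.
  under [X in _ = X -> _]eq_sw => h1 h2 do under eq_sw => g1 y1 do under eq_sw => g2 g3 do
    under eq_sw => x1 z do under eq_sw => x2 x3 do under eq_sw => y2 y3 do rewrite -scalerA.
  rewrite !sw_bone; [|mlin..].
  rewrite !bmul1l.
  set L := sw2 x _; set R := sw2 x _.
  have -> : L = w bone x y.
    rewrite -[RHS](sw_counitl2 (F := w bone)); last by mlin.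
    by do 2!apply: eq_sw => ? ?; rewrite omega_unit counitM counit1 mul1r.
  move=> ->; rewrite /R.
  under eq_sw => x1 z do under eq_sw => x2 x3 do under eq_sw => y2 y3 do
    rewrite [w bone bone x3]omega_unit counit1 mul1r scalerA.
  apply: eq_sw => x1 z; rewrite exchange_sw; apply: eq_sw => y1 y2.
  rewrite -[in RHS](sw_counitr (F := fun z => w bone z y2)); last by mlin.
  rewrite lin_swE; last by mlin_eta.
  by apply: eq_sw => x2 x3; rewrite bmul1l -scalerA; congr (_ *: _); apply: mulrC.
have vw x y : \sw_(x1, x2 <- x) \sw_(y1, y2 <- y) omegaV bone x1 y1 *: w bone x2 y2
    = counit x * counit y.
  have := omegaVl bone x y.
  rewrite -[sw2 bone _]/(\sw_(h1, h2 <- bone) \sw_(x1, x2 <- x) \sw_(y1, y2 <- y)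
    omegaV h1 x1 y1 *: w h2 x2 y2).
  by rewrite sw_bone ?counit1 ?mul1r //; mlin.
transitivity (w bone h g) => //; rewrite -vw -[LHS](sw_counitl2 (F := w bone)); last by mlin.
transitivity (\sw_(h1, h2 <- h) \sw_(g1, g2 <- g) \sw_(a1, a2 <- h1) \sw_(c1, c2 <- g1)
    omegaV bone a1 c1 *: (omega bone a2 c2 *: w bone h2 g2)).
  do 2!apply: eq_sw => ? ?; rewrite -vw /sw2 /tsum scaler_suml; apply: eq_bigr => p _.
  by rewrite scaler_suml; apply: eq_bigr => q _; rewrite scalerA.
rewrite (sw_coassoc2 (F := fun a1 c1 a2 c2 x y =>
  omegaV bone a1 c1 *: (omega bone a2 c2 *: w bone x y))); [|mlin|mlin].
do 2!apply: eq_sw => ? ?; rewrite [in RHS]ww lin_sw2E //.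
by mlin_eta.
Qed.

End OmegaUnit.

Section CocycleZigzag.
Variables (k : fieldType) (H : coquasiHopf k) (R : algebra k).
Variables (C : crossedSystem H R) (tau : H -> H -> R).
Hypothesis tauB : bilin tau.
Hypothesis tau_sigma : forall h g,
  \sw_(h1, h2 <- h) \sw_(g1, g2 <- g) (tau h1 g1 ∙ sigma C h2 g2) =
  (counit h * counit g) *: aone.
Hint Resolve tauB : multilinear.

(** The reason why π is a retraction: both sides of [sigma_cocycle_inv], evaluated
by [zigzag].  On the side of τ the product h_3 g_3 collapses to 1 and leaves the
left side below; on the side of ω the product g_1 l_1 collapses and leaves ω,
whose [zigzag] is the counit. *)
Lemma zigzag_tau_sigma h :
  zigzag h (fun a g l => \sw_(a1, a2 <- a) \sw_(g1, g2 <- g)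
    (cact C a1 (tau g1 l) ∙ sigma C a2 g2)) = counit h *: aone.
Proof.
transitivity (zigzag h (fun a g l =>
  \sw_(a1, a2 <- a) \sw_(g1, g2 <- g) \sw_(l1, l2 <- l)
    (cact C a1 (tau g1 l1) ∙
     \sw_(x1, x2 <- a2) \sw_(y1, y2 <- g2) sigma C x1 y1 ∙ sigma C (x2 ∗ y2) l2))).
  transitivity (zigzag h (fun a g l =>
    \sw_(a1, a2 <- a) \sw_(g1, g2 <- g)
    \sw_(x1, x2 <- a1) \sw_(y1, y2 <- g1) \sw_(l1, l2 <- l)
      (cact C x1 (tau y1 l1) ∙ sigma C x2 y2 ∙ sigma C (a2 ∗ g2) l2))).
    rewrite (zigzag_beta _ (F := fun l a g y => \sw_(x1, x2 <- a) \sw_(y1, y2 <- g)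
      \sw_(l1, l2 <- l) (cact C x1 (tau y1 l1) ∙ sigma C x2 y2 ∙ sigma C y l2)));
      [|mlin|mlin].
    apply: eq_zigzag => a g l; do 2!apply: eq_sw => ? ?.
    rewrite -[in LHS](sw_counitr (F := fun l => cact C _ (tau _ l) ∙ sigma C _ _)); last by mlin.
    apply: eq_sw => l1 l2; rewrite sigma1l linZ ?amul1r //; mlin_eta.
  apply: eq_zigzag => a g l.
  rewrite (sw_coassoc2 (F := fun x1 y1 x2 y2 a g => \sw_(l1, l2 <- l)
    (cact C x1 (tau y1 l1) ∙ sigma C x2 y2 ∙ sigma C (a ∗ g) l2))); [|mlin|mlin].
  apply: eq_sw => a1 a2; apply: eq_sw => g1 g2; rewrite -exchange_sw_sw.
  apply: eq_sw => l1 l2; rewrite lin_sw2E; last by mlin_eta.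
  by do 2!apply: eq_sw => ? ?; rewrite amulA.
under eq_zigzag => a g l do rewrite -sigma_cocycle_inv //.
rewrite -(zigzag_omega aone).
transitivity (zigzag h (fun a g l => \sw_(g1, g2 <- g) \sw_(l1, l2 <- l)
   \sw_(a1, a2 <- a) omega a2 g2 l2 *: sigma C a1 (g1 ∗ l1))).
  by apply: eq_zigzag => a g l; rewrite exchange_sw_sw.
rewrite (zigzag_alpha _ (F := fun a g l y => \sw_(a1, a2 <- a) omega a2 g l *: sigma C a1 y));
  [|mlin|mlin].
apply: eq_zigzag => a g l.
rewrite -[RHS](sw_counitl (F := fun a => omega a g l *: aone)); last by mlin.
by apply: eq_sw => a1 a2; rewrite sigma1r !scalerA mulrC.
Qed.
End CocycleZigzag.

(** * The projection onto the coinvariants *)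

Section Coaction.
Variables (k : fieldType) (H : coquasiBialgebra k) (R : algebra k).
Variables (C : crossedSystem H R) (M : coquasiHopfModule C).

(** Coassociativity of the coaction, in functional form. *)
Lemma coact_coassoc (W : lmodType k) (F : M -> H -> H -> W) m : trilin F ->
  \tsum_(m0, m1 <- coact m) \tsum_(a, b <- coact m0) F a b m1 =
  \tsum_(m0, m1 <- coact m) \sw_(a, b <- m1) F m0 a b.
Proof.
move=> FT.
pose G (t : (M ⊗ H) ⊗ H) := \tsum_(x, c <- t) \tsum_(a, b <- x) F a b c.
have GL : is_lin G by rewrite /G; mlin.
transitivity (G (\tsum_(m0, m1 <- coact m) coact m0 ⊗ m1)).
  rewrite (lin_tsumE _ _ GL); apply: eq_tsum => m0 m1.
  by rewrite /G tsum_pure //; mlin.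
rewrite coactA (lin_tsumE _ _ GL); apply: eq_tsum => m0 m1.
rewrite (lin_tsumE _ _ GL); apply: eq_tsum => a b.
by rewrite /G tsum_pure; [rewrite tsum_pure //; mlin | mlin].
Qed.

(** On coinvariants the factor ω(1, h, g) of the quasi-associativity is trivial. *)
Lemma coinv_hactA (n : M) h g : coact n = n ⊗ bone ->
  (n ∘ h) ∘ g = \sw_(h1, h2 <- h) \sw_(g1, g2 <- g) (n ◃ sigma C h1 g1) ∘ (h2 ∗ g2).
Proof.
move=> nE; rewrite hactA nE tsum_pure; last by mlin.
rewrite /sw3; apply: eq_sw => h1 x; rewrite exchange_sw; apply: eq_sw => g1 y.
rewrite -[RHS](sw_counitr2 (F := fun x y => (n ◃ sigma C h1 g1) ∘ (x ∗ y))); last by mlin.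
by do 2!apply: eq_sw => ? ?; rewrite omega_unitl.
Qed.
End Coaction.

Section Projection.
Variables (k : fieldType) (H : coquasiHopf k) (R : algebra k).
Variables (C : crossedSystem H R) (tau : H -> H -> R).
Hypothesis tauB : bilin tau.
Hypothesis tau_sigma : forall h g,
  \sw_(h1, h2 <- h) \sw_(g1, g2 <- g) (tau h1 g1 ∙ sigma C h2 g2) =
  (counit h * counit g) *: aone.
Hint Resolve tauB : multilinear.
Variable M : coquasiHopfModule C.

Definition proj_term (m : M) (g l : H) : M :=
  \sw_(g1, g2 <- g) (m ◃ tau g1 l) ∘ g2.

(** π(m) = [m_0 τ(S(m_3), m_5)] ∘ S(m_2) β(m_1) α(m_4): splitting g = S(m_2) reverses
its legs. *)
Definition proj (m : M) : M := \tsum_(m0, m1 <- coact m) zag m1 (proj_term m0).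

Lemma proj_term_trilin : trilin proj_term.
Proof. by rewrite /proj_term; mlin. Qed.
Hint Resolve proj_term_trilin : multilinear.

Lemma proj_lin : is_lin proj.
Proof. by rewrite /proj /zag; mlin. Qed.

(** The second leg of the coaction is m_1 times the last leg of β(m_2) S(m_3), which
[zigzag_beta] replaces by 1. *)
Lemma coact_proj m : coact (proj m) = proj m ⊗ bone.
Proof.
have coact_term m0 g l : coact (proj_term m0 g l) =
    \tsum_(a, b <- coact m0) \sw_(x, y <- g) proj_term a x l ⊗ (b ∗ y).
  rewrite /proj_term lin_swE; last by mlin_eta.
  transitivity (\tsum_(a, b <- coact m0) \sw_(x, y <- g) \sw_(y1, y2 <- y)
      (a ◃ tau x l) ∘ y1 ⊗ (b ∗ y2)).
    rewrite [RHS]exchange_tsum; apply: eq_sw => x y.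
    rewrite coact_hact coact_ract tsum_tsum; last by mlin.
    by apply: eq_tsum => a b; rewrite tsum_pure //; mlin.
  apply: eq_tsum => a b.
  rewrite -(sw_coassoc (F := fun x y z => (a ◃ tau x l) ∘ y ⊗ (b ∗ z))); last by mlin.
  by apply: eq_sw => x y; rewrite (lin_swE (f := fun z => z ⊗ (b ∗ y))) //; mlin.
rewrite /proj lin_tsumE; last by mlin_eta.
under eq_tsum => m0 m1.
  rewrite lin_zagE; last by mlin_eta.
  under eq_zag => g l do rewrite coact_term.
  rewrite zag_tsum; over.
rewrite (coact_coassoc (F := fun a b c => zag c (fun g l =>
  \sw_(x, y <- g) proj_term a x l ⊗ (b ∗ y)))); last by rewrite /zag; mlin.
rewrite (lin_tsumE (g := fun z => z ⊗ bone)); last by mlin.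
apply: eq_tsum => m0 m1.
rewrite (lin_zagE (f := fun z => z ⊗ bone)); last by mlin.
rewrite -zigzag_counit; last by mlin.
(* the coaction supplied the first leg that [zag] lacks *)
rewrite -[LHS]/(zigzag m1 (fun b g l => \sw_(x, y <- g) proj_term m0 x l ⊗ (b ∗ y))).
rewrite -(zigzag_beta _ (F := fun l a g y => counit a *: (proj_term m0 g l ⊗ y)));
  [|mlin|mlin].
apply: eq_zigzag => a g l; rewrite exchange_sw; apply: eq_sw => x y.
by rewrite -[LHS](sw_counitl (F := fun a => proj_term m0 x l ⊗ (a ∗ y))) //; mlin.
Qed.

(** Moving r = τ(g_1, l) past h in (n ∘ h) r, then merging the two actions of H on the
coinvariant n, leaves n [h_1 · τ(g_1, l)] σ(h_2, g_2) ∘ (h_3 g_3). *)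
Lemma proj_hact (n : M) h : coact n = n ⊗ bone -> proj (n ∘ h) = counit h *: n.
Proof.
move=> nE; transitivity (zigzag h (fun a => proj_term (n ∘ a))).
  rewrite /proj coact_hact nE tsum_pure; last by mlin.
  rewrite tsum_tsum; last by rewrite /zag; mlin.
  by apply: eq_tsum => a b; rewrite tsum_pure ?bmul1l //; rewrite /zag; mlin.
transitivity (zigzag h (fun a g l => \sw_(a1, a2 <- a) \sw_(g1, g2 <- g)
    \sw_(x1, x2 <- a1) \sw_(y1, y2 <- g1)
      (n ◃ (cact C x1 (tau y1 l) ∙ sigma C x2 y2)) ∘ (a2 ∗ g2))).
  apply: eq_zigzag => a g l.
  rewrite (sw_coassoc2 (F := fun x1 y1 x2 y2 a g =>
    (n ◃ (cact C x1 (tau y1 l) ∙ sigma C x2 y2)) ∘ (a ∗ g))); [|mlin|mlin].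
  rewrite [RHS]exchange_sw; apply: eq_sw => g1 g2.
  rewrite hact_ract (lin_swE (f := fun z => z ∘ g2)); last by mlin.
  apply: eq_sw => a1 a2; rewrite coinv_hactA.
    by do 2!apply: eq_sw => ? ?; rewrite ractA.
  by rewrite coact_ract nE tsum_pure //; mlin.
rewrite (zigzag_beta _ (F := fun l a g y => \sw_(x1, x2 <- a) \sw_(y1, y2 <- g)
  (n ◃ (cact C x1 (tau y1 l) ∙ sigma C x2 y2)) ∘ y)); [|mlin|mlin].
rewrite -[n in RHS]ract1 -(linZ _ _ (f := fun r => n ◃ r)); last by mlin.
rewrite -(zigzag_tau_sigma tauB tau_sigma) /zigzag lin_swE; last by mlin_eta.
apply: eq_sw => a x; rewrite lin_zagE; last by mlin_eta.
apply: eq_zag => g l; rewrite lin_sw2E; last by mlin_eta.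
by do 2!apply: eq_sw => ? ?; rewrite hact1.
Qed.

Lemma exchange_sw_coact (W : zmodType) m h (F : H -> H -> M -> H -> W) :
  \sw_(x, y <- h) \tsum_(a, b <- coact m) F x y a b =
  \tsum_(a, b <- coact m) \sw_(x, y <- h) F x y a b.
Proof. exact: exchange_tsum. Qed.

(** Quasi-associativity turns the left side into a sum in which τ(g_1, l_1) meets
σ(g_2, l_2); the two cancel. *)
Lemma sw_proj_term_hact m g l :
  \sw_(l1, l2 <- l) proj_term m g l1 ∘ l2 =
  \tsum_(a, b <- coact m) \sw_(g1, g2 <- g) \sw_(l1, l2 <- l)
    omega b g2 l2 *: (a ∘ (g1 ∗ l1)).
Proof.
transitivity (\sw_(l1, y <- l) \sw_(g1, x <- g) \tsum_(a, b <- coact m)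
  \sw_(x1, x2, x3 <- x) \sw_(y1, y2, y3 <- y)
    omega b x3 y3 *: ((a ◃ tau g1 l1 ◃ sigma C x1 y1) ∘ (x2 ∗ y2))).
  apply: eq_sw => l1 y; rewrite (lin_swE (f := fun z => z ∘ y)); last by mlin.
  apply: eq_sw => g1 x; rewrite hactA coact_ract tsum_tsum; last by mlin.
  by apply: eq_tsum => a b; rewrite tsum_pure //; mlin.
under eq_sw => l1 y do rewrite exchange_sw_coact.
rewrite exchange_sw_coact; apply: eq_tsum => a b; rewrite exchange_sw.
pose K r x y := \sw_(x1, x2 <- x) \sw_(y1, y2 <- y)
  omega b x2 y2 *: ((a ◃ r) ∘ (x1 ∗ y1)).
have KT : trilin K by rewrite /K; mlin.
transitivity (\sw_(g1, x <- g) \sw_(l1, y <- l) \sw_(x1, z <- x) \sw_(y1, t <- y)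
    K (tau g1 l1 ∙ sigma C x1 y1) z t).
  apply: eq_sw => g1 x; apply: eq_sw => l1 y; apply: eq_sw => x1 z.
  by rewrite [LHS]exchange_sw /K; do 3!apply: eq_sw => ? ?; rewrite ractA.
rewrite -(sw_coassoc2 (F := fun g1 l1 x1 y1 z t => K (tau g1 l1 ∙ sigma C x1 y1) z t));
  [|mlin|mlin].
transitivity (K aone g l); last first.
  by rewrite /K; do 2!apply: eq_sw => ? ?; rewrite ract1.
rewrite -[RHS]sw_counitl2; last by mlin.
apply: eq_sw => g1 g2; apply: eq_sw => l1 l2.
rewrite -(lin_sw2E (f := fun r => K r g2 l2)); last by mlin.
by rewrite tau_sigma (linZ _ _ (f := fun r => K r g2 l2)) //; mlin.
Qed.

Lemma sw_proj_hact m : \tsum_(m0, m1 <- coact m) proj m0 ∘ m1 = m.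
Proof.
transitivity (\tsum_(m0, m1 <- coact m) \tsum_(a, b <- coact m0)
    zag b (fun g l => proj_term a g l ∘ m1)).
  apply: eq_tsum => m0 m1; rewrite (lin_tsumE (g := fun z => z ∘ m1)); last by mlin.
  by apply: eq_tsum => a b; rewrite (lin_zagE (f := fun z => z ∘ m1)) //; mlin.
rewrite (coact_coassoc (F := fun a b y => zag b (fun g l => proj_term a g l ∘ y)));
  last by rewrite /zag; mlin.
under eq_tsum => m0 m1.
  rewrite (zag_sw _ (F := fun g l y => proj_term m0 g l ∘ y)); last by mlin.
  under eq_zag => g l do rewrite sw_proj_term_hact.
  rewrite zag_tsum; over.
rewrite (coact_coassoc (F := fun a b y => zag y (fun g l =>
  \sw_(g1, g2 <- g) \sw_(l1, l2 <- l) omega b g2 l2 *: (a ∘ (g1 ∗ l1)))));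
  last by rewrite /zag; mlin.
rewrite -[RHS]coact_counit; apply: eq_tsum => m0 m1; rewrite -zigzag_omega.
rewrite -[LHS]/(zigzag m1 (fun b g l =>
  \sw_(g1, g2 <- g) \sw_(l1, l2 <- l) omega b g2 l2 *: (m0 ∘ (g1 ∗ l1)))).
rewrite (zigzag_alpha _ (F := fun b g l y => omega b g l *: (m0 ∘ y))); [|mlin|mlin].
by apply: eq_zigzag => b g l; rewrite hact1.
Qed.
End Projection.

(** * The equivalence *)

Section InverseMorphisms.
Variables (k : fieldType) (H : coquasiBialgebra k) (R : algebra k).
Variable C : crossedSystem H R.

Lemma can_lin (U V : lmodType k) (f : {linear U -> V}) (g : V -> U) :
  cancel f g -> cancel g f -> is_lin g.
Proof. by move=> fK gK a x y; rewrite -{1}(gK x) -{1}(gK y) -linearP fK. Qed.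

(** A bijective morphism is an isomorphism, so only the comparison maps need to be
shown to be morphisms. *)
Definition rmod_inv (M N : rightModule R) (f : rmodHom M N) (g : N -> M)
  (fK : cancel f g) (gK : cancel g f) : rmodHom N M.
Proof.
exists (mk_linear (can_lin fK gK)) => n r /=.
by rewrite -{1}(gK n) -rmod_hom_ract fK.
Defined.

Definition chm_inv (M N : coquasiHopfModule C) (f : chmHom M N) (g : N -> M)
  (fK : cancel f g) (gK : cancel g f) : chmHom N M.
Proof.
exists (rmod_inv fK gK) => [n|n h] /=; last first.
  by rewrite -{1}(gK n) -chm_hom_hact fK.
have gL := can_lin fK gK.
rewrite -[in RHS](gK n) chm_hom_coact tsum_tsum; last by mlin.
rewrite -[LHS]tsum_id; apply: eq_tsum => m0 m1.
by rewrite tsum_pure ?fK //; mlin.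
Defined.
End InverseMorphisms.

Section UnitIso.
Variables (k : fieldType) (H : coquasiBialgebra k) (R : algebra k).
Variables (C : crossedSystem H R) (N : rightModule R).

Lemma coinv_unit_subproof (n : N) :
  (n ⊗ bone : ind_module C N) \in @is_coinv _ _ _ (ind_module C N).
Proof.
by apply/eqP; rewrite /= ind_coactE /sw2 comul1 tsum_pure //; mlin.
Qed.

Definition coinv_unit_map (n : N) : coinv (ind_module C N) :=
  Coinv (coinv_unit_subproof n).

Lemma coinv_unit_map_lin : is_lin coinv_unit_map.
Proof. by case: (pure_bilin N H) => pl _ a x y; apply: val_inj; apply: pl. Qed.

Definition coinv_unit : rmodHom N (coinv_module (ind_module C N)).
Proof.
exists (mk_linear coinv_unit_map_lin) => n r; apply: val_inj.
by rewrite /= ind_ractE /sw2 comul1 tsum_pure ?cact_bone //; mlin.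
Defined.

Definition coinv_unit_inv (x : coinv (ind_module C N)) : N :=
  \tsum_(n, h <- (val x : N ⊗ H)) counit h *: n.

Lemma coinv_unitK : cancel coinv_unit coinv_unit_inv.
Proof.
by move=> n; rewrite /coinv_unit_inv tsum_pure ?counit1 ?scale1r //; mlin.
Qed.

(** Apply id ⊗ ε ⊗ id to n ⊗ h_1 ⊗ h_2 = n ⊗ h ⊗ 1 (summation understood). *)
Lemma coinv_unit_invK : cancel coinv_unit_inv coinv_unit.
Proof.
move=> x; apply: val_inj; rewrite /= /coinv_unit_inv.
have xE : ind_coact (val x : N ⊗ H) = (val x : N ⊗ H) ⊗ bone := coinvP x.
pose eps (t : (N ⊗ H) ⊗ H) : N ⊗ H := \tsum_(y, h <- t) \tsum_(n, g <- y) counit g *: (n ⊗ h).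
have epsL : is_lin eps by rewrite /eps; mlin.
transitivity (eps (ind_coact (val x : N ⊗ H))).
  rewrite xE /eps tsum_pure; last by mlin.
  rewrite (lin_tsumE (g := fun n => n ⊗ bone)); last by mlin.
  by apply: eq_tsum => n h; rewrite (linZ _ _ (f := fun n => n ⊗ bone)) //; mlin.
rewrite -[RHS]tsum_id /ind_coact (lin_tsumE _ _ epsL); apply: eq_tsum => n h.
rewrite lin_swE // -[RHS](sw_counitl (F := fun h => n ⊗ h)); last by mlin.
by apply: eq_sw => a b; rewrite /eps tsum_pure; [rewrite tsum_pure //; mlin | mlin].
Qed.
End UnitIso.

Section Counit.
Variables (k : fieldType) (H : coquasiBialgebra k) (R : algebra k).
Variables (C : crossedSystem H R) (M : coquasiHopfModule C).

Lemma coinv_val_lin : is_lin (fun n : coinv M => (val n : M)).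
Proof. by []. Qed.
Hint Resolve coinv_val_lin ind_ract_bilin ind_coact_lin ind_hact_bilin : multilinear.

Definition hact_map (x : coinv M ⊗ H) : M := \tsum_(n, h <- x) val n ∘ h.

Lemma hact_map_lin : is_lin hact_map.
Proof. by rewrite /hact_map; mlin. Qed.
Hint Resolve hact_map_lin : multilinear.

Lemma hact_mapE n h : hact_map (n ⊗ h) = val n ∘ h.
Proof. by rewrite /hact_map tsum_pure //; mlin. Qed.

Lemma hact_map_ract x r :
  hact_map (ind_ract C (N := coinv_module M) x r) = hact_map x ◃ r.
Proof.
apply: (@tens_ext _ _ _ _ (fun x => hact_map (ind_ract C (N := coinv_module M) x r))
  (fun x => hact_map x ◃ r)); [mlin | mlin | move=> n h].
rewrite ind_ractE hact_mapE hact_ract lin_swE //; last exact: hact_map_lin.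
by apply: eq_sw => a b; rewrite hact_mapE.
Qed.

Lemma coact_hact_map x : coact (hact_map x) =
  \tsum_(m0, m1 <- ind_coact (N := coinv_module M) x) hact_map m0 ⊗ m1.
Proof.
apply: (@tens_ext _ _ _ _ (fun x => coact (hact_map x))
  (fun x => \tsum_(m0, m1 <- ind_coact (N := coinv_module M) x) hact_map m0 ⊗ m1));
  [mlin | mlin | move=> n h].
rewrite ind_coactE hact_mapE coact_hact coinvP tsum_pure; last by mlin.
rewrite [in RHS]/sw2 tsum_tsum; last by mlin.
by apply: eq_tsum => a b; rewrite tsum_pure ?hact_mapE ?bmul1l //; mlin.
Qed.

Lemma hact_map_hact x g :
  hact_map (ind_hact C (N := coinv_module M) x g) = hact_map x ∘ g.
Proof.
apply: (@tens_ext _ _ _ _ (fun x => hact_map (ind_hact C (N := coinv_module M) x g))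
  (fun x => hact_map x ∘ g)); [mlin | mlin | move=> n h].
rewrite ind_hactE hact_mapE coinv_hactA ?coinvP // lin_sw2E; last exact: hact_map_lin.
by do 2!apply: eq_sw => ? ?; rewrite hact_mapE.
Qed.

Definition hact_hom : chmHom (ind_module C (coinv_module M)) M :=
  @ChmHom _ _ _ _ (ind_module C (coinv_module M)) M
    (@RmodHom _ _ (ind_module C (coinv_module M)) M
      (mk_linear hact_map_lin) hact_map_ract)
    coact_hact_map hact_map_hact.
End Counit.

Section Inverse.
Variables (k : fieldType) (H : coquasiHopf k) (R : algebra k).
Variables (C : crossedSystem H R) (tau : H -> H -> R).
Hypothesis tauB : bilin tau.
Hypothesis tau_sigma : forall h g,
  \sw_(h1, h2 <- h) \sw_(g1, g2 <- g) (tau h1 g1 ∙ sigma C h2 g2) =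
  (counit h * counit g) *: aone.
Variable M : coquasiHopfModule C.

Lemma coinv_proj_subproof (m : M) : proj tau m \in @is_coinv _ _ _ M.
Proof. by apply/eqP; apply: coact_proj. Qed.

Definition coinv_proj (m : M) : coinv M := Coinv (coinv_proj_subproof m).

Lemma coinv_proj_lin : is_lin coinv_proj.
Proof. by move=> a x y; apply: val_inj; apply: proj_lin. Qed.
Hint Resolve coinv_proj_lin coinv_val_lin hact_map_lin : multilinear.

Definition hact_map_inv (m : M) : coinv M ⊗ H :=
  \tsum_(m0, m1 <- coact m) coinv_proj m0 ⊗ m1.

Lemma hact_map_invK : cancel hact_map_inv (hact_hom M).
Proof.
move=> m; rewrite -[RHS](sw_proj_hact tauB tau_sigma) /= /hact_map_inv.
rewrite lin_tsumE; last exact: hact_map_lin.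
by apply: eq_tsum => m0 m1; rewrite hact_mapE.
Qed.

Lemma hact_mapK : cancel (hact_hom M) hact_map_inv.
Proof.
move=> x /=.
apply: (@tens_ext _ _ _ _ (fun x => hact_map_inv (hact_map x)) (fun x => x));
  [by rewrite /hact_map_inv; mlin | mlin | move=> n h].
rewrite hact_mapE /hact_map_inv coact_hact coinvP tsum_pure; last by mlin.
rewrite {1}/sw2 tsum_tsum; last by mlin.
rewrite -[RHS](sw_counitl (F := fun h => n ⊗ h)); last by mlin.
apply: eq_tsum => a b; rewrite tsum_pure ?bmul1l; last by mlin.
rewrite -(linZ _ _ (f := fun n => n ⊗ b)); last by mlin.
congr (_ ⊗ _); apply: val_inj.
by rewrite /= (proj_hact tauB tau_sigma) ?coinvP.
Qed.
End Inverse.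

Theorem theorem24 (k : fieldType) (H : coquasiHopf k) (R : algebra k)
    (C : crossedSystem H R) (sigma_inv : conv_invertible (sigma C)) :
  inverse_equivalences (tensorH C) (coinvariants C).
Proof.
case: sigma_inv => tau [tauB tau_conv].
have tau_sigma h g : \sw_(h1, h2 <- h) \sw_(g1, g2 <- g) (tau h1 g1 ∙ sigma C h2 g2) =
    (counit h * counit g) *: aone by case: (tau_conv h g).
split; constructor.
- exists (fun N => rmod_inv (@coinv_unitK _ _ _ C N) (@coinv_unit_invK _ _ _ C N))
    (coinv_unit C).
  + by move=> N; apply: rmodHom_ext => x; apply: coinv_unit_invK.
  + by move=> N; apply: rmodHom_ext => x; apply: coinv_unitK.
  + move=> N P f; apply: rmodHom_ext => x; rewrite /= /coinv_unit_inv /=.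
    rewrite /ind_map tsum_tsum; last by mlin.
    rewrite lin_tsumE; last by mlin_eta.
    by apply: eq_tsum => n h; rewrite tsum_pure ?linearZ //; mlin.
- exists (@hact_hom _ _ _ C)
    (fun M => chm_inv (hact_mapK tauB tau_sigma (M := M))
                (hact_map_invK tauB tau_sigma (M := M))).
  + by move=> M; apply: chmHom_ext => x; apply: hact_mapK.
  + by move=> M; apply: chmHom_ext => x; apply: hact_map_invK.
  + move=> M N f; apply: chmHom_ext => x /=.
    apply: (@tens_ext _ _ _ _ (fun x => hact_map (ind_map (coinv_hom f) x))
      (fun x => f (hact_map x))).
    * exact: lin_comp (@hact_map_lin _ _ _ C N) (ind_map_lin (coinv_hom f)).
    * by have hL := @hact_map_lin _ _ _ C M; mlin.
    * by move=> n h; rewrite ind_mapE !hact_mapE /= chm_hom_hact.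
Qed.
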